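(* Let $y\in\mathbb R$ and $z=e^{\mathrm i y}$. The following functions of $\cos y$ and $\sin y$ can be $\delta$-approximated by Laurent polynomials in $z$ as stated. (1) Let $n\in\mathbb N$ and $\delta>0$. With $d=O\bigl(\sqrt{n\ln(1/\delta)}\bigr)$, the Laurent polynomials $$p_{n,d}(\cos y)=\sum_{j=0}^{d}\frac{c_{n,j}}2\,(z^j+z^{-j}),\qquad p_{n,d}(\sin y)=\sum_{j=0}^{d}\frac{c_{n,j}}2\,\mathrm i^j\bigl((-z)^j+z^{-j}\bigr)$$ are $\delta$-approximations to $\cos^n y$ and $\sin^n y$, respectively; their degree is $O\bigl(\sqrt{n\ln(1/\delta)}\bigr)$. (2) Let $\beta>0$ and $\delta\in(0,1/2]$. With $t_\beta=O(\beta+\ln(1/\delta))$ and $d=O\bigl(\sqrt{t_\beta\ln(1/\delta)}\bigr)$, $$e^{-\beta}\sum_{k=0}^{t_\beta}\frac{(-\beta)^k}{k!}\,p_{k,d}(\cos y)\quad\text{and}\quad e^{-\beta}\sum_{k=0}^{t_\beta}\frac{(-\beta)^k}{k!}\,p_{k,d}(\sin y)$$ are $\delta$-approximations to $e^{-\beta(1+\cos y)}$ and $e^{-\beta(1+\sin y)}$, respectively; their degree is $O\bigl(\sqrt{t_\beta\ln(1/\delta)}\bigr)$. (3) Let $\gamma\ge0$ and $\delta\in(0,1/2]$. With $t_\gamma=O(\gamma^2+\ln(1/\delta))$ and $d=O\bigl(\sqrt{t_\gamma\ln(1/\delta)}\bigr)$, $$e^{-\gamma^2/2}\sum_{k=0}^{t_\gamma}\frac{(-\gamma^2/2)^k}{k!}\sum_{j=0}^{d}\frac{c_{k,j}}2\,(z^{2j}+z^{-2j})$$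 and $$e^{-\gamma^2/2}\sum_{k=0}^{t_\gamma}\frac{(-\gamma^2/2)^k}{k!}\,p_{k,d}(T_2(\sin y)),\qquad p_{k,d}(T_2(\sin y))=\sum_{j=0}^{d}\frac{c_{k,j}}2(-1)^j(z^{2j}+z^{-2j}),$$ are $\delta$-approximations to $e^{-(\gamma\cos y)^2}$ and $e^{-(\gamma\sin y)^2}$, respectively; their degree is $O\bigl(\sqrt{t_\gamma\ln(1/\delta)}\bigr)$. (4) Let $\lambda>0$ and $\delta\in(0,O(1)]$. With $t_\lambda=O(\lambda^2+\ln(1/\delta))$ and $d=O\bigl(\sqrt{t_\lambda\ln(1/\delta)}\bigr)$, the expression $$\frac{2\lambda e^{-\lambda^2/2}}{\sqrt\pi}\sum_{k=0}^{t_\lambda}\frac{(-\lambda^2/2)^k}{k!}\,I_k(y)$$ is a $\delta$-approximation to $\operatorname{erf}(\lambda\cos y)$ when $$I_k(y)=\int_0^{\cos y}p_{k,d}(T_2(u))\,du=\sum_{j=0}^{d}\frac{c_{k,j}}2\left(\frac{z^{2j+1}+z^{-2j-1}}{2(2j+1)}-\frac{z^{|2j-1|}+z^{-|2j-1|}}{2(2j-1)}\right),$$ and is a $\delta$-approximation to $\operatorname{erf}(\lambda\sin y)$ when $$I_k(y)=\int_0^{\sin y}p_{k,d}(T_2(u))\,du=\frac{c_{k,0}}2(-\mathrm i)(z-z^{-1})+\sum_{j=1}^{d}\frac{c_{k,j}}{2\mathrm i}(-1)^j\left(\frac{z^{2j+1}-z^{-2j-1}}{2(2j+1)}+\frac{z^{2j-1}-z^{-2j+1}}{2(2j-1)}\right);$$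 in both cases the degree is $O\bigl(\sqrt{t_\lambda\ln(1/\delta)}\bigr)$.
   Context: A ''$\delta$-approximation'' is one for which the supremum over $y\in\mathbb R$ of the absolute difference is at most $\delta$. The degree of a Laurent polynomial $\sum_{k=-l}^{l}a_kz^k$ is the highest power of $z$. $T_j(x)=\cos(j\arccos x)$ is the Chebyshev polynomial of the first kind, so $T_2(x)=2x^2-1$. For integers $n,d\ge0$, $p_{n,d}(x)=\sum_{j=0}^{d}c_{n,j}T_j(x)$, where $c_{n,j}=2^{1-n}\binom{n}{(n-j)/2}$ if $j\neq0$ and $n-j$ is even, $c_{n,0}=2^{-n}\binom{n}{n/2}$ if $n$ is even, and $c_{n,j}=0$ otherwise (with $c_{n,j}=0$ for $j>n$); thus $x^n=\sum_{j=0}^n c_{n,j}T_j(x)$. The error function is $\operatorname{erf}(\lambda x)=\frac{2\lambda}{\sqrt\pi}\int_0^x e^{-(\lambda u)^2}\,du$. The notation $\delta\in(0,O(1)]$ means that $\delta$ is positive and at most some constant.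
   Formalization: In (1) the bounds on d and on the degree are C·sqrt(n ln(1/δ)) rounded up to an integer, with the root read as 0 for δ>1; unrounded, the claim fails as δ→1 (n=1 forces d=0 with error 1>δ), and for δ≤1/2 the rounding is absorbed in the constant. *)

(* Defs.v *)
From HB Require Import structures.
From mathcomp Require Export all_boot all_order all_algebra.
From mathcomp Require Export all_classical all_reals all_analysis.
From mathcomp Require Export complex.
From mathcomp.multinomials Require Export freeg.

Set Implicit Arguments.
Unset Strict Implicit.
Unset Printing Implicit Defensive.

Import Order.TTheory GRing.Theory Num.Theory.
Local Open Scope ring_scope.

(* e^{iy}, through Euler's formula. *)
Definition expi {R : realType} (y : R) : R[i] := (cos y +i* sin y)%C.

(* sup_y |f y - g y| <= delta; the supremum is taken in the extended reals, so
   that an unbounded difference has supremum +oo. *)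
Definition delta_approx {R : realType} (delta : R) (f g : R -> R[i]) : Prop :=
  (ereal_sup [set (Normc.normc (f y - g y))%:E | y in [set: R]]
     <= delta%:E)%E.

(* A Laurent polynomial sum_k a_k z^k is the finitely supported family of its
   coefficients a_k, k : int. *)
Definition laurent (R : realType) := {freeg int / R[i]}.

Definition zpow {R : realType} (k : int) : laurent R := << 1 *g k >>.

Definition leval {R : realType} (L : laurent R) (z : R[i]) : R[i] :=
  \sum_(k <- dom L) coeff k L * z ^ k.

(* The highest power of z; dom L is the (duplicate-free) list of the k whose
   coefficient is nonzero. By convention the zero polynomial has degree 0. *)
Definition ldeg {R : realType} (L : laurent R) : int :=
  \big[Order.max/head 0 (dom L)]_(k <- dom L) k.

(* Meaningful for -1 <= x <= 1, which holds wherever it is used below. *)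
Definition cheb {R : realType} (j : nat) (x : R) : R := cos (j%:R * acos x).

Definition cheb_coef {R : realType} (n j : nat) : R :=
  if (n < j)%N || odd (n - j) then 0
  else if j == 0%N then 2 ^- n * 'C(n, n./2)%:R
  else 2 * 2 ^- n * 'C(n, (n - j)./2)%:R.

Definition pnd {R : realType} (n d : nat) (x : R) : R :=
  \sum_(j < d.+1) cheb_coef n j * cheb j x.

(* c_{n,j} / 2 as a complex number. *)
Definition half_coef {R : realType} (n j : nat) : R[i] :=
  (cheb_coef n j / 2 : R)%:C%C.

(* p_{n,d}(cos y), p_{n,d}(sin y), p_{n,d}(T_2(cos y)) and p_{n,d}(T_2(sin y))
   as Laurent polynomials in z = e^{iy}. In lpnd_sin, (-z)^j is (-1)^j z^j. *)
Definition lpnd_cos {R : realType} (n d : nat) : laurent R :=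
  \sum_(j < d.+1) half_coef n j *: (zpow j%:Z + zpow (- j%:Z)).

Definition lpnd_sin {R : realType} (n d : nat) : laurent R :=
  \sum_(j < d.+1) (half_coef n j * 'i%C ^+ j)
     *: ((-1) ^+ j *: zpow j%:Z + zpow (- j%:Z)).

Definition lpnd_T2cos {R : realType} (n d : nat) : laurent R :=
  \sum_(j < d.+1) half_coef n j *: (zpow (2 * j%:Z) + zpow (- (2 * j%:Z))).

Definition lpnd_T2sin {R : realType} (n d : nat) : laurent R :=
  \sum_(j < d.+1) (half_coef n j * (-1) ^+ j)
     *: (zpow (2 * j%:Z) + zpow (- (2 * j%:Z))).

(* The oriented integral of f from 0 to x. *)
Definition integral0 {R : realType} (f : R -> R) (x : R) : R :=
  if 0 <= x then \int[lebesgue_measure]_(u in `[0, x]) f u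
  else - \int[lebesgue_measure]_(u in `[x, 0]) f u.

(* erf_scaled lambda x is erf (lambda x). *)
Definition erf_scaled {R : realType} (lambda x : R) : R :=
  2 * lambda / Num.sqrt pi
    * integral0 (fun u => expR (- (lambda * u) ^+ 2)) x.

(* The integral of p_{k,d}(T_2(u)) for u from 0 to x, and its expression as a
   Laurent polynomial in z for x = cos y and x = sin y. *)
Definition Iint {R : realType} (k d : nat) (x : R) : R :=
  integral0 (fun u => pnd k d (cheb 2 u)) x.

Definition lI_cos {R : realType} (k d : nat) : laurent R :=
  \sum_(j < d.+1) half_coef k j *:
    ((2 * (2 * j%:R + 1))^-1
        *: (zpow (2 * j%:Z + 1) + zpow (- (2 * j%:Z) - 1))
     - (2 * (2 * j%:R - 1))^-1
        *: (zpow `|2 * j%:Z - 1| + zpow (- `|2 * j%:Z - 1|))).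

Definition lI_sin {R : realType} (k d : nat) : laurent R :=
  (half_coef k 0 * - 'i%C) *: (zpow 1 - zpow (-1))
  + \sum_(1 <= j < d.+1) ((cheb_coef k j : R)%:C%C / (2 * 'i%C) * (-1) ^+ j) *:
    ((2 * (2 * j%:R + 1))^-1
        *: (zpow (2 * j%:Z + 1) - zpow (- (2 * j%:Z) - 1))
     + (2 * (2 * j%:R - 1))^-1
        *: (zpow (2 * j%:Z - 1) - zpow (- (2 * j%:Z) + 1))).

(* a * sum_{k=0}^t (-b)^k/k! F_k, for real numbers F_k and for Laurent
   polynomials F_k. *)
Definition exp_sum {R : realType} (a b : R) (t : nat) (F : nat -> R) : R :=
  a * \sum_(k < t.+1) (- b) ^+ k / k`!%:R * F k.

Definition lexp_sum {R : realType} (a b : R) (t : nat)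
    (F : nat -> laurent R) : laurent R :=
  a%:C%C *: \sum_(k < t.+1) ((- b) ^+ k / k`!%:R : R)%:C%C *: F k.

(* Main.v *)
Require Import Defs.
From HB Require Import structures.
From mathcomp Require Import zify ring lra.

Import Order.TTheory GRing.Theory Num.Theory.
Import numFieldNormedType.Exports.
Local Open Scope ring_scope.
Local Open Scope complex_scope.

(* The coefficient c_{n,j} is the probability that a simple random walk is at
   distance j from the origin after n steps, so truncating x^n at degree d
   costs at most the probability of a distance above d, which is bounded by
   Chernoff's inequality. When delta is close to 1, d is allowed to be much
   smaller than sqrt n, and one uses instead that the law of the walk decreases
   away from the origin. Truncating the exponential series at
   t = O(beta + ln (1/delta)) costs a Poisson tail, and T_2 turns the Gaussian
   into e^{-b (1 + cos)}. For the error function, integrating T_{2j} gains a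
   factor 1/j, which compensates the factor lambda since
   d + 1 >= 4 lambda. *)

(** * Chebyshev coefficients and the simple random walk *)

(** One fact carries the analysis of the walk: an eigenfunction g of its transition operator, with
    eigenvalue c, has expectation c^n g(0) after n steps. The constant 1, cos (j y) and cosh (j x)
    are eigenfunctions; they give the total mass, the Chebyshev expansion of cos^n y and the
    exponential moment behind Chernoff's inequality. Sines need no estimates of their own: sin y =
    cos (y - pi/2), and the powers of i and -1 in the Laurent polynomials are the phases of this
    shift. The weights e^{-b} b^k / k! sum to at most 1, so a truncation error bounded uniformly in
    k <= t is not amplified by the alternating exponential sum. *)

Lemma cheb_coef_gt (R : realType) n j : (n < j)%N -> cheb_coef n j = 0 :> R.
Proof. by rewrite /cheb_coef => ->. Qed.

Lemma cheb_coef_odd (R : realType) n j : odd (n + j) -> cheb_coef n j = 0 :> R.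
Proof.
rewrite /cheb_coef; case: ltnP => //= jn; rewrite oddD => onj.
by rewrite oddB // onj.
Qed.

Lemma cheb_coef0E (R : realType) m :
  cheb_coef m.*2 0 = 2 ^- m.*2 * 'C(m.*2, m)%:R :> R.
Proof. by rewrite /cheb_coef subn0 odd_double /= doubleK. Qed.

Lemma cheb_coefSE (R : realType) m j :
  cheb_coef (m.*2 + j.+1) j.+1
    = 2 * 2 ^- (m.*2 + j.+1) * 'C(m.*2 + j.+1, m)%:R :> R.
Proof.
by rewrite /cheb_coef ltnNge leq_addl addnK odd_double /= doubleK.
Qed.

Lemma cheb_coef_ge0 (R : realType) n j : 0 <= cheb_coef n j :> R.
Proof. by rewrite /cheb_coef; do 2 case: ifP => _ //; rewrite !mulr_ge0. Qed.

Variant parity_spec n j : Prop :=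
  | ParityGt of (n < j)%N
  | ParityOdd of odd (n + j)
  | ParityEven m of n = (m.*2 + j)%N.

Lemma parityP n j : parity_spec n j.
Proof.
case: (ltnP n j) => [|jn]; first by constructor 1.
case: (boolP (odd (n + j))) => [|onj]; first by constructor 2.
apply: (@ParityEven _ _ (n - j)./2).
rewrite -[LHS](subnK jn) -{1}(odd_double_half (n - j)) oddB // -oddD.
by rewrite (negbTE onj).
Qed.

Lemma pow2S_inv (R : realType) n : 2 * 2 ^- n.+1 = 2 ^- n :> R.
Proof. by rewrite exprS; field; rewrite expf_neq0. Qed.

(** This recurrence and the next two are Pascal's rule read as one step of the walk. Distance 0 is
    reached from distance 1 with probability 1/2, but distance 1 from distance 0 with probability 1,
    so [cheb_coef n 0] is not halved in [cheb_coefS1]. *)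
Lemma cheb_coefS0 (R : realType) n :
  cheb_coef n.+1 0 = cheb_coef n 1 / 2 :> R.
Proof.
case: (parityP n 1) => [n1|on|m ->].
- by rewrite (@cheb_coef_gt _ n 1) // mul0r cheb_coef_odd //; lia.
- by rewrite !cheb_coef_odd ?mul0r // addn0 -addn1.
- have -> : (m.*2 + 1).+1 = m.+1.*2 by rewrite doubleS addn1.
  rewrite cheb_coef0E cheb_coefSE doubleS addn1 binS.
  have -> : 'C(m.*2.+1, m.+1) = 'C(m.*2.+1, m).
    by rewrite -bin_sub; [congr ('C(_, _))|]; lia.
  by rewrite natrD -(pow2S_inv R m.*2.+1); field; rewrite expf_neq0.
Qed.

Lemma cheb_coefS1 (R : realType) n :
  cheb_coef n.+1 1 = cheb_coef n 0 + cheb_coef n 2 / 2 :> R.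
Proof.
case: (parityP n 0) => [//|on|m ->].
  by rewrite !cheb_coef_odd ?mul0r ?addr0 //; lia.
rewrite addn0 cheb_coef0E -addn1 cheb_coefSE addn1 pow2S_inv.
case: m => [|m]; first by rewrite (@cheb_coef_gt _ _ 2) // mul0r addr0 !bin0.
have -> : m.+1.*2 = (m.*2 + 2)%N by lia.
rewrite cheb_coefSE binS natrD.
by field; rewrite expf_neq0.
Qed.

Lemma cheb_coefSS (R : realType) n j :
  cheb_coef n.+1 j.+2 = (cheb_coef n j.+1 + cheb_coef n j.+3) / 2 :> R.
Proof.
case: (parityP n j.+1) => [nj|on|m ->].
- by rewrite !cheb_coef_gt ?addr0 ?mul0r //; lia.
- by rewrite !cheb_coef_odd ?addr0 ?mul0r //; lia.
have -> : (m.*2 + j.+1).+1 = (m.*2 + j.+2)%N by lia.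
rewrite !cheb_coefSE; case: m => [|m].
  rewrite (@cheb_coef_gt _ _ j.+3) // addr0 !bin0 !add0n exprS.
  by field; rewrite expf_neq0.
have -> : (m.+1.*2 + j.+2 = (m.*2 + j.+3).+1)%N by lia.
have -> : (m.+1.*2 + j.+1 = m.*2 + j.+3)%N by lia.
rewrite !cheb_coefSE binS natrD pow2S_inv.
by field; rewrite expf_neq0.
Qed.

(* The transition operator of the distance of the walk to the origin. *)
Definition walk_step {R : realType} (g : nat -> R) (j : nat) : R :=
  if j is i.+1 then (g i + g i.+2) / 2 else g 1.

Lemma cheb_coef_sum_widen (R : realType) n N (g : nat -> R) : (n < N)%N ->
  \sum_(j < N) cheb_coef n j * g j = \sum_(j < n.+1) cheb_coef n j * g j.
Proof.
move=> nN; rewrite -!(big_mkord xpredT (fun j => cheb_coef n j * g j)).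
rewrite (big_cat_nat _ (n := n.+1)) //= [X in _ + X]big_nat_cond.
rewrite [X in _ + X]big1 ?addr0 //.
by move=> i /andP[/andP[ni _] _]; rewrite cheb_coef_gt // mul0r.
Qed.

(** Duality: moving the law of the walk forward by one step amounts to applying the transition
    operator to the function. *)
Lemma cheb_coef_step (R : realType) n (g : nat -> R) :
  \sum_(j < n.+2) cheb_coef n.+1 j * g j
    = \sum_(j < n.+1) cheb_coef n j * walk_step g j.
Proof.
(* Zero terms are added so that, once the boundary terms are split off, both sides are left with
   sums over [n.+2] indices. *)
rewrite -(@cheb_coef_sum_widen R n.+1 n.+4 g); last by lia.
rewrite -(@cheb_coef_sum_widen R n n.+3 (walk_step g)); last by lia.
rewrite [RHS]big_ord_recl [LHS]big_ord_recl [X in _ + X = _]big_ord_recl.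
rewrite /= /bump /= cheb_coefS0 cheb_coefS1.
have -> : \sum_(i < n.+2) cheb_coef n.+1 i.+2 * g i.+2 = 
   \sum_(i < n.+2) cheb_coef n i.+1 * (g i.+2 / 2) +
   \sum_(i < n.+2) cheb_coef n i.+3 * (g i.+2 / 2) :> R.
  rewrite -big_split /=; apply: eq_bigr => i _.
  by rewrite cheb_coefSS; field.
have -> : \sum_(i < n.+2) cheb_coef n i.+1 * ((g i + g i.+2) / 2) = 
   \sum_(i < n.+2) cheb_coef n i.+1 * (g i.+2 / 2) +
   \sum_(i < n.+2) cheb_coef n i.+1 * (g i / 2) :> R.
  rewrite -big_split /=; apply: eq_bigr => i _.
  by field.
have -> : \sum_(i < n.+2) cheb_coef n i.+1 * (g i / 2)
   = cheb_coef n 1 * (g 0 / 2) + cheb_coef n 2 * (g 1 / 2) +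
     \sum_(i < n.+2) cheb_coef n i.+3 * (g i.+2 / 2) :> R.
  rewrite [LHS]big_ord_recl [X in _ + X = _]big_ord_recl /= /bump /=.
  rewrite addrA; congr (_ + _).
  rewrite [RHS]big_ord_recr [X in _ = X + _]big_ord_recr /=.
  by rewrite !(@cheb_coef_gt _ n) ?mul0r ?addr0 //; lia.
by field.
Qed.

Lemma cheb_coef_sum_eigen (R : realType) n (g : nat -> R) (c : R) :
  (forall j, walk_step g j = c * g j) ->
  \sum_(j < n.+1) cheb_coef n j * g j = c ^+ n * g 0.
Proof.
move=> gc; elim: n => [|n IHn].
  by rewrite big_ord1 expr0 /cheb_coef /= expr0 invr1 bin0 !mul1r.
rewrite cheb_coef_step.
under eq_bigr => j _ do rewrite gc mulrCA.
by rewrite -mulr_sumr IHn exprS mulrA.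
Qed.

Lemma cheb_coef_sum1 (R : realType) n : \sum_(j < n.+1) cheb_coef n j = 1 :> R.
Proof.
transitivity (\sum_(j < n.+1) cheb_coef n j * 1 : R).
  by apply: eq_bigr => j _; rewrite mulr1.
rewrite (@cheb_coef_sum_eigen _ _ (fun=> 1) 1) ?expr1n ?mulr1 //.
by case=> [|j] /=; field.
Qed.

Lemma cheb_coef_sum_cos (R : realType) n (y : R) :
  \sum_(j < n.+1) cheb_coef n j * cos (j%:R * y) = cos y ^+ n.
Proof.
rewrite (@cheb_coef_sum_eigen _ _ (fun j => cos (j%:R * y)) (cos y)).
  by rewrite mul0r cos0 mulr1.
case=> [|j] /=; first by rewrite mul0r cos0 mul1r mulr1.
have -> : j%:R * y = j.+1%:R * y - y by rewrite -addn1 natrD; ring.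
have -> : j.+2%:R * y = j.+1%:R * y + y by rewrite -(addn1 j.+1) natrD; ring.
by rewrite cosB cosD; field.
Qed.

Lemma expR_le_inv1B (R : realType) (x : R) : x < 1 -> expR x <= (1 - x)^-1.
Proof.
move=> x1; rewrite -[x in X in X <= _]opprK expRN lef_pV2 ?posrE ?expR_gt0 ?subr_gt0 //.
exact: expR_ge1Dx.
Qed.

(** The sharp exponent is x^2 / 2, but on this range the elementary chain cosh x <= 1 / (1 - x^2) <=
    1 + 2 x^2 is enough; the loss only affects constants. *)
Lemma cosh_le_expR (R : realType) (x : R) : 0 <= x <= 1 / 2 ->
  (expR x + expR (- x)) / 2 <= expR (2 * x ^+ 2).
Proof.
move=> /andP[x0 x2]; apply: le_trans (expR_ge1Dx _).
have e1 : expR x <= (1 - x)^-1 by apply: expR_le_inv1B; lra.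
have e2 : expR (- x) <= (1 + x)^-1.
  by rewrite -[x in X in _ <= X]opprK; apply: expR_le_inv1B; lra.
apply: (@le_trans _ _ (((1 - x)^-1 + (1 + x)^-1) / 2)); first by lra.
have -> : ((1 - x)^-1 + (1 + x)^-1) / 2 = (1 - x ^+ 2)^-1.
  by field; apply/and3P; split; apply/eqP; nra.
have x21 : x ^+ 2 <= 1 / 4 by nra.
have x20 : 0 <= x ^+ 2 by exact: sqr_ge0.
rewrite -[_^-1]mul1r ler_pdivrMr; nra.
Qed.

(* The probability that the walk is at distance at least m from the origin. *)
Definition cheb_tail {R : realType} (n m : nat) : R :=
  1 - \sum_(j < m) cheb_coef n j.

Lemma cheb_coef_sum_tail (R : realType) n m (g : nat -> R) :
  \sum_(j < n.+1) cheb_coef n j * g j - \sum_(j < m) cheb_coef n j * g j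
    = \sum_(m <= j < n.+1) cheb_coef n j * g j.
Proof.
case: (leqP m n.+1) => [mn|nm].
  rewrite -!(big_mkord xpredT (fun j => cheb_coef n j * g j)).
  by rewrite (big_cat_nat _ (n := m)) //= addrAC subrr add0r.
by rewrite (@cheb_coef_sum_widen R n m g (ltnW nm)) subrr big_geq // ltnW.
Qed.

Lemma cheb_tailE (R : realType) n m :
  cheb_tail n m = \sum_(m <= j < n.+1) cheb_coef n j :> R.
Proof.
have := cheb_coef_sum_tail R n m (fun=> 1).
under [X in X - _ = _]eq_bigr do rewrite mulr1.
under [X in _ - X = _]eq_bigr do rewrite mulr1.
under [RHS]eq_bigr do rewrite mulr1.
by rewrite cheb_coef_sum1.
Qed.

Lemma cheb_tail_ge0 (R : realType) n m : 0 <= cheb_tail n m :> R.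
Proof. by rewrite cheb_tailE sumr_ge0 // => j _; exact: cheb_coef_ge0. Qed.

Lemma cheb_tail_eq0 (R : realType) n m : (n < m)%N -> cheb_tail n m = 0 :> R.
Proof. by move=> nm; rewrite cheb_tailE big_geq. Qed.

(** Serves twice: with cosines and [M] = 1 for the powers, and with [cheb_prim] and [M] = 1 / (d +
    1) for the integrals. *)
Lemma cheb_coef_sum_tail_le (R : realType) n m (g : nat -> R) (M : R) :
  (forall j, (m <= j)%N -> `|g j| <= M) ->
  `|\sum_(j < n.+1) cheb_coef n j * g j - \sum_(j < m) cheb_coef n j * g j|
    <= M * cheb_tail n m.
Proof.
move=> gM; rewrite cheb_coef_sum_tail cheb_tailE mulr_sumr.
apply: le_trans (ler_norm_sum _ _ _) _.
rewrite !big_nat; apply: ler_sum => j /andP[mj _].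
rewrite normrM (ger0_norm (cheb_coef_ge0 _ _ _)) mulrC.
by apply: ler_wpM2r; [exact: cheb_coef_ge0 | exact: gM].
Qed.

(* Chernoff's bound with parameter m / (4 n). *)
Lemma cheb_tail_le_expR (R : realType) n m : (0 < n)%N ->
  cheb_tail n m <= 2 * expR (- (m%:R ^+ 2 / (8 * n%:R))) :> R.
Proof.
move=> n0; case: (leqP m n) => [mn|nm]; last first.
  by rewrite cheb_tail_eq0 // mulr_ge0 ?expR_ge0.
have n0' : 0 < n%:R :> R by rewrite ltr0n.
have mn' : m%:R <= n%:R :> R by rewrite ler_nat.
pose x : R := m%:R / (4 * n%:R).
have x0 : 0 <= x by rewrite divr_ge0 // mulr_ge0.
have x2 : x <= 1 / 2 by rewrite /x ler_pdivrMr; lra.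
(* [g j] is 2 cosh (x j), an eigenfunction with eigenvalue [c] = cosh x. *)
pose g (j : nat) := expR (x * j%:R) + expR (- (x * j%:R)).
pose c := (expR x + expR (- x)) / 2.
have gE j : walk_step g j = c * g j.
  rewrite /g /c; case: j => [|j] /=.
    by rewrite mulr0 oppr0 expR0 mulr1; field.
  have -> : x * j%:R = x * j.+1%:R - x by rewrite -addn1 natrD; ring.
  have -> : x * j.+2%:R = x * j.+1%:R + x by rewrite -(addn1 j.+1) natrD; ring.
  by rewrite !opprD !opprK !expRD; field.
have sumg := @cheb_coef_sum_eigen _ n g c gE.
have g0 : g 0%N = 2 by rewrite /g mulr0 oppr0 expR0.
(* Markov's inequality: e^{-x m} g(j) is nonnegative, and at least 1 for j >= m. *)
apply: (@le_trans _ _ (expR (- (x * m%:R)) * \sum_(j < n.+1) cheb_coef n j * g j)).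
  rewrite cheb_tailE mulr_sumr.
  rewrite -(big_mkord xpredT (fun j => expR (- (x * m%:R)) * (cheb_coef n j * g j))).
  rewrite [leRHS](big_cat_nat _ (n := m)) /=; [|by []|by lia].
  rewrite -[leLHS]add0r; apply: lerD.
    apply: sumr_ge0 => j _; rewrite !mulr_ge0 ?expR_ge0 ?cheb_coef_ge0 //.
    by rewrite addr_ge0 ?expR_ge0.
  rewrite !big_nat; apply: ler_sum => j /andP[mj _].
  rewrite mulrCA -[leLHS]mulr1; apply: ler_wpM2l; first exact: cheb_coef_ge0.
  rewrite /g mulrDr -!expRD; apply: ler_wpDr; first exact: expR_ge0.
  by rewrite -[leLHS]expR0 ler_expR addrC subr_ge0 ler_wpM2l // ler_nat.
rewrite sumg g0 mulrA [leLHS]mulrC.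
apply: ler_wpM2l => //.
apply: (@le_trans _ _ (expR (- (x * m%:R)) * expR (2 * x ^+ 2) ^+ n)).
  apply: ler_wpM2l; first exact: expR_ge0.
  apply: lerXn2r; rewrite ?nnegrE ?expR_ge0 //.
    by rewrite divr_ge0 // addr_ge0 ?expR_ge0.
  by apply: cosh_le_expR; rewrite x0.
(* With x = m / (4 n), the exponent is - m^2 / (4 n) + 2 n x^2 = - m^2 / (8 n). *)
rewrite -expRM_natr -expRD ler_expR /x.
rewrite [leLHS](_ : _ = - (m%:R ^+ 2 / (8 * n%:R))) //.
by field; rewrite gt_eqF.
Qed.

(** Makes Chernoff's bound uniform over the powers of the truncated exponential series. At k = 0 the
    walk has not moved, so the tail vanishes for m > 0. *)
Lemma cheb_tail_le_expRW (R : realType) k t m : (k <= t)%N -> (0 < t)%N -> (0 < m)%N ->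
  cheb_tail k m <= 2 * expR (- (m%:R ^+ 2 / (8 * t%:R))) :> R.
Proof.
move=> kt t0 m0; have [->|k0] := posnP k.
  by rewrite cheb_tail_eq0 // mulr_ge0 ?expR_ge0.
apply: le_trans (cheb_tail_le_expR _ _ _ k0) _.
apply: ler_wpM2l => //; rewrite ler_expR lerN2.
apply: ler_wpM2l; first exact: sqr_ge0.
by rewrite lef_pV2 ?posrE ?mulr_gt0 ?ltr0n // ler_pM2l // ler_nat.
Qed.

(** Initial averages of a nonincreasing sequence decrease; cross-multiplying avoids dividing by [a]
    = 0. *)
Lemma ler_sum_nonincreasing (R : realType) (v : nat -> R) a b :
  (forall j, v j.+1 <= v j) -> (a <= b)%N ->
  a%:R * \sum_(j < b) v j <= b%:R * \sum_(j < a) v j.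
Proof.
move=> vS; elim: b => [|b IHb]; first by rewrite leqn0 => /eqP ->.
rewrite leq_eqVlt => /orP[/eqP -> //|ab].
have v_le i j : (i <= j)%N -> v j <= v i.
  by elim: j => [|j IHj]; [rewrite leqn0 => /eqP ->
    |rewrite leq_eqVlt => /orP[/eqP -> //|/IHj]; exact: le_trans].
have : a%:R * v b <= \sum_(j < a) v j.
  have -> : a%:R * v b = \sum_(j < a) v b.
    by rewrite sumr_const card_ord -[RHS]mulr_natl.
  by apply: ler_sum => j _; apply: v_le; have := ltn_ord j; lia.
have := IHb ab.
rewrite big_ord_recr /= mulrDr -(natr1 b) mulrDl mul1r.
exact: lerD.
Qed.

Lemma leq_bin_half n m : (m.+1.*2 <= n)%N -> ('C(n, m) <= 'C(n, m.+1))%N.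
Proof.
move=> mn; have := mul_bin_left n m.
rewrite -(leq_pmul2l (ltn0Sn m)) => ->; rewrite leq_mul2r; apply/orP; right.
lia.
Qed.

(* Distance 0 is attained at one position only, the others at two: once the
   weight at 0 is doubled (w), the weights are nonincreasing along each parity
   class, and adding neighbouring weights (v) removes the parity. *)
Lemma cheb_tail_anticoncentration (R : realType) n d m : (d <= m)%N ->
  d%:R * (1 - cheb_tail n m) <= 4 * m%:R * (1 - cheb_tail n d.+1) :> R.
Proof.
move=> dm; rewrite /cheb_tail !subKr.
pose w j : R := if j is 0 then 2 * cheb_coef n 0 else cheb_coef n j.
pose v j := w j + w j.+1.
have c0 j := cheb_coef_ge0 R n j.
have w0 j : 0 <= w j by case: j => [|j] /=; rewrite ?mulr_ge0.
have w_gt j : (n < j)%N -> w j = 0.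
  by case: j => //= j nj; rewrite cheb_coef_gt.
have w_odd j : odd (n + j) -> w j = 0.
  by case: j => [|j] /= onj; rewrite cheb_coef_odd ?mulr0.
(* Doubling the weight at 0 makes one binomial formula valid for every j. *)
have wE k j : n = (k.*2 + j)%N -> w j = 2 * 2 ^- n * 'C(n, k)%:R.
  case: j => [|j] /= ->; last by rewrite cheb_coefSE.
  by rewrite addn0 cheb_coef0E mulrA.
have wSS j : w j.+2 <= w j.
  case: (parityP n j.+2) => [nj|on|k nE]; first by rewrite w_gt.
    by rewrite w_odd.
  rewrite (wE k) // (wE k.+1); last by lia.
  apply: ler_wpM2l; first by rewrite mulr_ge0.
  by rewrite ler_nat leq_bin_half //; lia.
have vS j : v j.+1 <= v j by rewrite /v addrC lerD2r.
have := @ler_sum_nonincreasing R v d m vS dm.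
have cw j : cheb_coef n j <= w j.
  by case: j => [|j] //=; have := c0 0%N; lra.
have wc j : w j <= 2 * cheb_coef n j.
  by case: j => [|j] //=; have := c0 j.+1; lra.
have lev : \sum_(j < m) cheb_coef n j <= \sum_(j < m) v j.
  by apply: ler_sum => j _; rewrite /v ler_wpDr.
(* One factor 2 comes from [wc], the other from each [w j] occurring in at most two of the [v]. *)
have gev : \sum_(j < d) v j <= 4 * \sum_(j < d.+1) cheb_coef n j.
  have -> : 4 * \sum_(j < d.+1) cheb_coef n j
    = \sum_(j < d.+1) 2 * cheb_coef n j + \sum_(j < d.+1) 2 * cheb_coef n j :> R.
    by rewrite -!mulr_sumr; ring.
  rewrite big_split /=; apply: lerD.
    rewrite big_ord_recr /=; apply: ler_wpDr; first by rewrite mulr_ge0.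
    by apply: ler_sum.
  rewrite big_ord_recl /=; apply: ler_wpDl; first by rewrite mulr_ge0.
  by apply: ler_sum => j _; exact: (wc j.+1).
move=> h; apply: (@le_trans _ _ (d%:R * \sum_(j < m) v j)).
  exact: ler_wpM2l.
by apply: le_trans h _; rewrite [4 * _]mulrC -mulrA; exact: ler_wpM2l.
Qed.

Lemma expR1_ge2 (R : realType) : 2 <= expR 1 :> R.
Proof. by have := expR_ge1Dx (1 : R); lra. Qed.

Lemma expR_half_le2 (R : realType) : expR (1 / 2) <= 2 :> R.
Proof.
apply: le_trans (expR_le_inv1B _ _ _) _; first by lra.
by rewrite [leLHS](_ : _ = 2) //; field.
Qed.

Lemma ln_inv (R : realType) (x : R) : 0 < x -> expR (- ln (1 / x)) = x.
Proof. by move=> x0; rewrite expRN lnK ?posrE ?divr_gt0 // div1r invrK. Qed.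

Lemma cheb_tail_le1 (R : realType) n m : cheb_tail n m <= 1 :> R.
Proof. by rewrite /cheb_tail gerBl sumr_ge0 // => j _; exact: cheb_coef_ge0. Qed.

Lemma natr_absz_ceil (R : realType) (x : R) : 0 <= x ->
  x <= `|Num.ceil x|%N%:R < x + 1.
Proof.
move=> x0; have c0 : 0 <= Num.ceil x by rewrite ceil_ge0 ?(lt_le_trans _ x0) ?ltrN10.
rewrite natr_absz ger0_norm // ceil_ge /=.
by have := ceilB1_lt x; rewrite intrD; lra.
Qed.

(* For delta close to 1 the degree is below the standard deviation sqrt n, and
   the walk has to be shown to stay within d with probability at least
   1 - delta; otherwise Chernoff's bound suffices. *)
Lemma exists_cheb_tail_le (R : realType) n (delta : R) : 0 < delta ->
  exists2 d : nat,
    d%:Z = Num.ceil (40 * Num.sqrt (n%:R * ln (1 / delta))) &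
    cheb_tail n d.+1 <= delta.
Proof.
move=> delta0; set L := ln (1 / delta); set x := 40 * _.
have x0 : 0 <= x by rewrite mulr_ge0 ?sqrtr_ge0.
have /andP[xd dx] := natr_absz_ceil _ _ x0.
exists `|Num.ceil x|%N.
  rewrite gez0_abs //.
  by rewrite ceil_ge0 ?(lt_le_trans _ x0) ?ltrN10.
set d := `|_|%N in xd dx *.
have [delta1|delta1] := leP 1 delta.
  exact: le_trans (cheb_tail_le1 _ _ _) delta1.
have [->|n0] := posnP n; first by rewrite cheb_tail_eq0 // ltW.
have n0' : 0 < n%:R :> R by rewrite ltr0n.
have n1' : 1 <= n%:R :> R by rewrite ler1n.
have L0 : 0 < L by rewrite ln_gt0 // ltr_pdivlMr // mul1r.
have sn1 : 1 <= Num.sqrt n%:R :> R by rewrite -[leLHS]sqrtr1 ler_sqrt.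
have xE : x = 40 * Num.sqrt n%:R * Num.sqrt L by rewrite /x sqrtrM ?ler0n // mulrA.
have sqn : Num.sqrt n%:R ^+ 2 = n%:R :> R by rewrite sqr_sqrtr ?ler0n.
have sqL : Num.sqrt L ^+ 2 = L by rewrite sqr_sqrtr // ltW.
have sL0 : 0 < Num.sqrt L by rewrite sqrtr_gt0.
have deltaE : delta = expR (- L) by rewrite ln_inv.
(* Within four standard deviations lies at least half of the mass, since Chernoff's bound there is 2
   e^{-2} <= 1/2. *)
have m40 : 0 <= 4 * Num.sqrt n%:R :> R by rewrite mulr_ge0 ?sqrtr_ge0.
have /andP[mge mlt] := natr_absz_ceil _ _ m40.
set m := `|_|%N in mge mlt.
have tailm : cheb_tail n m <= 1 / 2 :> R.
  apply: le_trans (cheb_tail_le_expR _ _ _ n0) _.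
  have e2 : expR (- 2) <= 1 / 4 :> R.
    rewrite expRN -[1 / 4]invrK lef_pV2 ?posrE ?expR_gt0 ?invr_gt0 ?divr_gt0 //.
    have -> : expR 2 = expR 1 * expR 1 :> R by rewrite -expRD; congr expR; ring.
    have e1 := expR1_ge2 R; rewrite div1r invrK -[4](_ : 2 * 2 = 4); last by ring.
    by apply: ler_pM.
  have : expR (- (m%:R ^+ 2 / (8 * n%:R))) <= expR (- 2) :> R.
    rewrite ler_expR lerN2 ler_pdivlMr ?mulr_gt0 // -sqn.
    nra.
  lra.
(* If d <= m, anticoncentration gives d / 2 <= 20 sqrt n (1 - T) for the tail T beyond d. As d >= 40
   sqrt n sqrt L, this means sqrt L <= 1 - T; hence L <= sqrt L and T <= 1 - L <= e^{-L} = delta. *)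
case: (leqP d m) => [dm|md].
  have := cheb_tail_anticoncentration R n _ _ dm.
  have m0 : 0 < m%:R :> R by nra.
  have m5 : m%:R <= 5 * Num.sqrt n%:R :> R by lra.
  have t0 := cheb_tail_ge0 R n d.+1.
  set T := cheb_tail n d.+1 in t0 *; set Tm := cheb_tail n m in tailm *.
  move=> h.
  have h1 : d%:R * (1 / 2) <= d%:R * (1 - Tm) by apply: ler_wpM2l => //; lra.
  have h2 : 4 * m%:R * (1 - T) <= 4 * (5 * Num.sqrt n%:R) * (1 - T).
    apply: ler_wpM2r; first by rewrite subr_ge0; exact: cheb_tail_le1.
    lra.
  have h3 : 20 * Num.sqrt n%:R * Num.sqrt L <= 20 * Num.sqrt n%:R * (1 - T).
    have := le_trans h1 (le_trans h h2); lra.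
  rewrite ler_pM2l in h3; last by lra.
  have L1 : L <= Num.sqrt L by rewrite -{1}sqL; nra.
  rewrite deltaE; apply: le_trans (expR_ge1Dx _); lra.
(* If d > m, then 40 sqrt n sqrt L > 4 sqrt n, so L >= 1/100. Chernoff's exponent is at least 1600 L
   / 8 = 200 L, and the surplus 199 L >= 1 pays for the factor 2 <= e. *)
have md' : m%:R + 1 <= d%:R :> R by rewrite natr1 ler_nat.
have sL : 1 / 10 <= Num.sqrt L.
  have : Num.sqrt n%:R * (1 / 10) < Num.sqrt n%:R * Num.sqrt L by lra.
  by rewrite ltr_pM2l ?(lt_le_trans _ sn1) // => /ltW.
apply: le_trans (cheb_tail_le_expR _ _ _ n0) _.
apply: (@le_trans _ _ (expR 1 * expR (- (200 * L)))).
  apply: ler_pM; rewrite ?expR_ge0 ?expR1_ge2 //.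
  rewrite ler_expR lerN2 ler_pdivlMr ?mulr_gt0 // -sqn -sqL.
  have : 0 <= x <= d.+1%:R by rewrite x0 -natr1 (le_trans xd) // lerDl.
  move=> /andP[_ xd1]; have : x ^+ 2 <= d.+1%:R ^+ 2 by rewrite lerXn2r ?nnegrE.
  rewrite xE; apply: le_trans.
  by rewrite [leLHS](_ : _ = (40 * Num.sqrt n%:R * Num.sqrt L) ^+ 2) //; ring.
rewrite -expRD deltaE ler_expR.
nra.
Qed.

(** * Truncation of the exponential series *)

Lemma exp_partial_sum_le (R : realType) (x : R) n : 0 <= x ->
  \sum_(k < n) x ^+ k / k`!%:R <= expR x.
Proof.
move=> x0; rewrite -(big_mkord xpredT (fun k => x ^+ k / k`!%:R)).
rewrite /expR; apply: (@nondecreasing_cvgn_le R (series (exp_coeff x))).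
  apply: nondecreasing_series => k _ _; rewrite /exp_coeff /=.
  by rewrite divr_ge0 // exprn_ge0.
exact: is_cvg_series_exp_coeff.
Qed.

(** For k >= n one has |x|^k <= 2^{-n} (2 |x|)^k, so the tail is at most 2^{-n} times the
    exponential series at 2 |x|; no estimate of factorials is involved. *)
Lemma exp_partial_sum_tail_le (R : realType) (x : R) n :
  `|expR x - \sum_(k < n) x ^+ k / k`!%:R| <= 2 ^- n * expR (2 * `|x|).
Proof.
set S := \sum_(_ < _) _; set M := _ * _.
have H N : (n <= N)%N -> `|series (exp_coeff x) N - S| <= M.
  move=> nN; rewrite /S -(big_mkord xpredT (fun k => x ^+ k / k`!%:R)).
  rewrite /series /= (big_cat_nat _ (n := n)) //= /exp_coeff /= addrAC subrr add0r.
  apply: le_trans (ler_norm_sum _ _ _) _.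
  apply: (@le_trans _ _ (2 ^- n * \sum_(n <= k < N) (2 * `|x|) ^+ k / k`!%:R)).
    rewrite mulr_sumr !big_nat; apply: ler_sum => k /andP[nk _].
    rewrite normrM normrX [X in _ * X]ger0_norm ?invr_ge0 // mulrA.
    apply: ler_wpM2r; first by rewrite invr_ge0.
    rewrite exprMn mulrA -[leLHS]mul1r; apply: ler_wpM2r; first exact: exprn_ge0.
    by rewrite mulrC ler_pdivlMr ?exprn_gt0 // mul1r ler_eXn2l // ltr1n.
  apply: ler_wpM2l; first by rewrite invr_ge0 exprn_ge0.
  apply: le_trans (exp_partial_sum_le R _ N _); last by rewrite mulr_ge0.
  rewrite -(big_mkord xpredT (fun k => (2 * `|x|) ^+ k / k`!%:R)).
  rewrite [leRHS](big_cat_nat _ (n := n)) //=.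
  apply: ler_wpDl; last exact: lexx.
  apply: sumr_ge0 => k _.
  by rewrite divr_ge0 // exprn_ge0 // mulr_ge0.
rewrite ler_norml; apply/andP; split.
  rewrite lerBrDr; apply: limr_ge; first exact: is_cvg_series_exp_coeff.
  exists n => // N /= nN; have := H N nN; rewrite ler_norml => /andP[].
  by rewrite lerBrDr.
rewrite lerBlDr; apply: limr_le; first exact: is_cvg_series_exp_coeff.
exists n => // N /= nN; have := H N nN; rewrite ler_norml => /andP[_].
by rewrite lerBlDr.
Qed.

Lemma pow2_le_expR_half (R : realType) n : 2 ^- n <= expR (- (n%:R / 2)) :> R.
Proof.
rewrite expRN lef_pV2 ?posrE ?expR_gt0 ?exprn_gt0 // mulrC -[2^-1]div1r expRM_natr.
by rewrite lerXn2r ?nnegrE ?expR_ge0 // expR_half_le2.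
Qed.

Lemma ln_inv_ge_half (R : realType) (delta : R) : 0 < delta <= 1 / 2 ->
  1 / 2 <= ln (1 / delta).
Proof.
move=> /andP[d0 d2]; rewrite -ler_expR lnK ?posrE ?divr_gt0 //.
apply: le_trans (expR_half_le2 R) _.
by rewrite ler_pdivlMr //; lra.
Qed.

(** One choice of [t] and [d] for parts (2) to (4). The factor e^{3b} exceeds the e^b of the series
    tail by e^{2b}, which pays for the prefactor 2 lambda of the error function; the last inequality
    says d + 1 >= 4 lambda when b = lambda^2 / 2. The bound 1 <= 2 sqrt (t L) absorbs the additive 1
    in the degree 2 d + 1. *)
Lemma exists_truncation (R : realType) (b delta : R) :
  0 <= b -> 0 < delta <= 1 / 2 ->
  let L := ln (1 / delta) in
  exists t d : nat,
    [/\ (0 < t)%N,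
        t%:R <= 6 * b + 4 * L,
        d%:R <= 10 * Num.sqrt (t%:R * L),
        1 <= 2 * Num.sqrt (t%:R * L) &
        [/\ expR (3 * b) * 2 ^- t.+1 <= delta / 2,
            2 * expR (- (d.+1%:R ^+ 2 / (8 * t%:R))) <= delta / 2 &
            32 * b <= d.+1%:R ^+ 2]].
Proof.
move=> b0 delta12 L; have L2 : 1 / 2 <= L by exact: ln_inv_ge_half.
have /andP[d0 d2] := delta12.
have deltaE : delta = expR (- L) by rewrite ln_inv.
have /truncn_itv : 0 <= 6 * b + 4 * L by lra.
(* Rounding down keeps the upper bounds free of additive terms, while the errors depend on t + 1 and
   d + 1, which exceed the unrounded values. *)
set t := Num.truncn _ => /andP[tle tgt].
have t0 : (0 < t)%N by rewrite -(ltr_nat R) -(ltrD2r 1) natr1; lra.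
have t1 : 1 <= t%:R :> R by rewrite ler1n.
have tL0 : 0 <= t%:R * L by rewrite mulr_ge0 //; lra.
set x := Num.sqrt (t%:R * L); have x0 : 0 <= x := sqrtr_ge0 _.
have sqx : x ^+ 2 = t%:R * L by rewrite sqr_sqrtr.
have /truncn_itv : 0 <= 10 * x by lra.
set d := Num.truncn _ => /andP[dle dgt].
rewrite -natr1 in tgt.
have d2x : 100 * (t%:R * L) <= d.+1%:R ^+ 2.
  have : (10 * x) ^+ 2 <= d.+1%:R ^+ 2.
    by apply: lerXn2r; rewrite ?nnegrE //; lra.
  by rewrite exprMn sqx (_ : 10 ^+ 2 = 100) //; ring.
exists t, d; rewrite -/x; split => //.
  have : 1 / 2 <= x ^+ 2 by rewrite sqx; clear -t1 L2; nra.
  by move=> hx; rewrite leNgt; apply/negP => hx'; nra.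
split.
(* Since (t + 1) / 2 > 3 b + 2 L, the product is at most e^{-2L} = delta^2. *)
- apply: (@le_trans _ _ (expR (3 * b) * expR (- (t.+1%:R / 2)))).
    by apply: ler_wpM2l; [exact: expR_ge0 | exact: pow2_le_expR_half].
  rewrite -expRD; apply: (@le_trans _ _ (delta * delta)); last by nra.
  by rewrite deltaE -expRD ler_expR -natr1; lra.
(* The exponent is at least 100 t L / (8 t) >= 3 L, and 2 delta^3 <= delta / 2. *)
- apply: (@le_trans _ _ (2 * (delta * delta * delta))); last by nra.
  apply: ler_wpM2l => //; rewrite deltaE -!expRD ler_expR -!opprD lerN2.
  rewrite ler_pdivlMr ?mulr_gt0 ?ltr0n //; nra.
- nra.
Qed.

(** * Evaluation of Laurent polynomials *)

(** [leval] sums over the support, which changes under addition; as the additive extension of k |->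
    z^k to the free module, it inherits additivity. *)
Lemma leval_fglift (R : realType) (L : laurent R) (z : R[i]) :
  leval L z = fglift (fun k : int => z ^ k : R[i]^o) L.
Proof.
pose f (k : int) : R[i]^o := z ^ k.
pose lift_hom := GRing.isAdditive.Build {freeg int / R[i]} R[i]^o (fglift f)
  (lift_is_additive f).
pose F : {additive {freeg int / R[i]} -> R[i]^o} := HB.pack (fglift f) lift_hom.
rewrite /leval -[in RHS](freeg_sumE L) -/f -[fglift f]/(F : _ -> _) raddf_sum /=.
by apply: eq_bigr => k _; rewrite liftU.
Qed.

Lemma leval0 (R : realType) (z : R[i]) : leval 0 z = 0.
Proof. by rewrite /leval dom0 big_nil. Qed.

Lemma levalB (R : realType) (L M : laurent R) z :
  leval (L - M) z = leval L z - leval M z.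
Proof. by rewrite !leval_fglift lift_is_additive. Qed.

Lemma levalD (R : realType) (L M : laurent R) z :
  leval (L + M) z = leval L z + leval M z.
Proof. by rewrite -[M in LHS]opprK -[- M]sub0r !levalB leval0; ring. Qed.

Lemma leval_sum (R : realType) I (r : seq I) P (F : I -> laurent R) z :
  leval (\sum_(i <- r | P i) F i) z = \sum_(i <- r | P i) leval (F i) z.
Proof.
by apply: (big_morph (leval^~ z)); [move=> L M; exact: levalD | exact: leval0].
Qed.

Lemma leval_monomial (R : realType) (a : R[i]) k z :
  leval (<< a *g k >> : laurent R) z = a * z ^ k.
Proof. by rewrite leval_fglift liftU. Qed.

Lemma levalZ (R : realType) (a : R[i]) (L : laurent R) z :
  leval (a *: L) z = a * leval L z.
Proof.
rewrite [a *: L]/(fgscale a L) /fgscale leval_sum /leval mulr_sumr.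
by apply: eq_bigr => k _; rewrite -/(leval _ _) leval_monomial mulrA.
Qed.

Lemma leval_zpow (R : realType) k (z : R[i]) : leval (zpow k) z = z ^ k.
Proof. by rewrite leval_monomial mul1r. Qed.

Lemma expiD (R : realType) (a b : R) : expi (a + b) = expi a * expi b.
Proof. by rewrite /expi cosD sinD; simpc; congr (_ +i* _); rewrite addrC. Qed.

Lemma expi0 (R : realType) : expi 0 = 1 :> R[i].
Proof. by rewrite /expi cos0 sin0. Qed.

Lemma expi_exprz (R : realType) (y : R) (k : int) :
  expi y ^ k = expi (k%:~R * y).
Proof.
have expi_nat n : expi y ^+ n = expi (n%:R * y).
  elim: n => [|n IHn]; first by rewrite mul0r expi0.
  by rewrite exprS IHn -expiD -addn1 natrD; congr expi; ring.
case: k => n; first by rewrite -exprnP expi_nat.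
rewrite NegzE -exprnN expi_nat intrN mulNr.
have : expi (n.+1%:R * y) * expi (- (n.+1%:R * y)) = 1.
  by rewrite -expiD subrr expi0.
by move=> /mulr1_eq ->.
Qed.

Lemma expiDN (R : realType) (a : R) : expi a + expi (- a) = (2 * cos a)%:C.
Proof. by rewrite /expi cosN sinN; simpc; congr (_ +i* _); ring. Qed.

Lemma expiBN (R : realType) (a : R) : expi a - expi (- a) = 'i%C * (2 * sin a)%:C.
Proof. by rewrite /expi cosN sinN; simpc; congr (_ +i* _); ring. Qed.

Lemma leval_zpowDN (R : realType) (k : int) (y : R) :
  leval (zpow k + zpow (- k)) (expi y) = (2 * cos (k%:~R * y))%:C.
Proof. by rewrite levalD !leval_zpow !expi_exprz intrN mulNr expiDN. Qed.

Lemma leval_zpowBN (R : realType) (k : int) (y : R) :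
  leval (zpow k - zpow (- k)) (expi y) = 'i%C * (2 * sin (k%:~R * y))%:C.
Proof. by rewrite levalB !leval_zpow !expi_exprz intrN mulNr expiBN. Qed.

Lemma leval_lpnd_cos (R : realType) n d (y : R) :
  leval (lpnd_cos n d) (expi y)
    = (\sum_(j < d.+1) cheb_coef n j * cos (j%:R * y))%:C.
Proof.
rewrite /lpnd_cos leval_sum rmorph_sum /=; apply: eq_bigr => j _.
rewrite levalZ leval_zpowDN /half_coef -rmorphM /=; congr _%:C.
by field.
Qed.

(** e^{i (y - pi/2)} = -i z, so i^j ((-z)^j + z^{-j}) = 2 cos (j (y - pi/2)). *)
Lemma leval_lpnd_sin (R : realType) n d (y : R) :
  leval (lpnd_sin n d) (expi y)
    = (\sum_(j < d.+1) cheb_coef n j * cos (j%:R * (y - pi / 2)))%:C.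
Proof.
rewrite /lpnd_sin leval_sum rmorph_sum /=; apply: eq_bigr => j _.
have -> : (cheb_coef n j * cos (j%:R * (y - pi / 2)))%:C
   = half_coef n j * (2 * cos (j%:R * (y - pi / 2)))%:C.
  by rewrite /half_coef -rmorphM /=; congr _%:C; field.
rewrite levalZ -mulrA; congr (_ * _).
rewrite -expiDN levalD levalZ !leval_zpow !expi_exprz intrN mulNr.
have expi_pihalf : expi (pi / 2) = 'i%C :> R[i].
  by rewrite /expi cos_pihalf sin_pihalf.
have -> : - (j%:R * (y - pi / 2)) = - (j%:R * y) + j%:Z%:~R * (pi / 2).
  by rewrite -[j%:Z%:~R]/(j%:R); ring.
have -> : j%:R * (y - pi / 2) = j%:R * y + j%:Z%:~R * (- (pi / 2)).
  by rewrite -[j%:Z%:~R]/(j%:R); ring.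
rewrite !expiD -(expi_exprz R (pi / 2)) -(expi_exprz R (- (pi / 2))) expi_pihalf.
have -> : expi (- (pi / 2)) = - 'i%C :> R[i].
  by rewrite /expi cosN sinN cos_pihalf sin_pihalf; simpc.
by rewrite -!exprnP [(- 'i%C) ^+ _]exprNn -[j%:Z%:~R]/(j%:R); ring.
Qed.

Lemma leval_lpnd_T2cos (R : realType) n d (y : R) :
  leval (lpnd_T2cos n d) (expi y)
    = (\sum_(j < d.+1) cheb_coef n j * cos (j%:R * (2 * y)))%:C.
Proof.
rewrite /lpnd_T2cos leval_sum rmorph_sum /=; apply: eq_bigr => j _.
rewrite levalZ leval_zpowDN /half_coef -rmorphM /=; congr _%:C.
have -> : (2 * j%:Z)%:~R * y = j%:R * (2 * y) by rewrite intrM -!pmulrn; ring.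
by field.
Qed.

Lemma cosDnatpi (R : realType) (a : R) n :
  cos (a + n%:R * pi) = (-1) ^+ n * cos a.
Proof. by rewrite mulr_natl alternatingn //; exact: cosDpi. Qed.

Lemma sinDnatpi (R : realType) (a : R) n :
  sin (a + n%:R * pi) = (-1) ^+ n * sin a.
Proof. by rewrite mulr_natl alternatingn //; exact: sinDpi. Qed.

Lemma leval_lpnd_T2sin (R : realType) n d (y : R) :
  leval (lpnd_T2sin n d) (expi y)
    = (\sum_(j < d.+1) cheb_coef n j * cos (j%:R * (2 * y + pi)))%:C.
Proof.
rewrite /lpnd_T2sin leval_sum rmorph_sum /=; apply: eq_bigr => j _.
rewrite mulrDr cosDnatpi levalZ leval_zpowDN /half_coef.
have -> : (2 * j%:Z)%:~R * y = j%:R * (2 * y) by rewrite intrM -!pmulrn; ring.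
have -> : (-1) ^+ j = ((-1) ^+ j : R)%:C by rewrite rmorphXn rmorphN1.
by rewrite -!rmorphM /=; congr _%:C; field.
Qed.

(* The value at cos y of the antiderivative of T_{2j} that vanishes at 0. *)
Definition cheb_prim {R : realType} (j : nat) (y : R) : R :=
  (cos ((2 * j%:R + 1) * y) / (2 * j%:R + 1)
   - cos ((2 * j%:R - 1) * y) / (2 * j%:R - 1)) / 2.

(** An odd integer, equal to -1 at j = 0. The general ring covers both the reals and the complex
    numbers. *)
Lemma natr_double_pred_neq0 (R : numDomainType) j : 2 * j%:R - 1 != 0 :> R.
Proof.
by rewrite subr_eq0 -natrM (eqr_nat R _ 1); apply/eqP; lia.
Qed.

Lemma natr_double_succ_neq0 (R : numDomainType) j : 2 * j%:R + 1 != 0 :> R.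
Proof. by rewrite -natrM natr1 pnatr_eq0. Qed.

Lemma leval_lI_cos (R : realType) k d (y : R) :
  leval (lI_cos k d) (expi y) = (\sum_(j < d.+1) cheb_coef k j * cheb_prim j y)%:C.
Proof.
rewrite /lI_cos leval_sum rmorph_sum /=; apply: eq_bigr => j _.
rewrite -[- (2 * j%:Z) - 1]opprD levalZ levalB !levalZ !leval_zpowDN.
have -> : (`|2 * j%:Z - 1|%:~R * y : R) = `|(2 * j%:Z - 1)%:~R| * y by rewrite intr_norm.
have -> : cos (`|(2 * j%:Z - 1)%:~R| * y) = cos ((2 * j%:R - 1) * y) :> R.
  have -> : (2 * j%:Z - 1)%:~R = 2 * j%:R - 1 :> R by rewrite intrB intrM.
  by case: ger0P => _ //; rewrite mulNr cosN.
have -> : (2 * j%:Z + 1)%:~R = 2 * j%:R + 1 :> R by rewrite intrD intrM.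
have -> : (2 * (2 * j%:R + 1))^-1 = ((2 * (2 * j%:R + 1))^-1 : R)%:C.
  by rewrite fmorphV !(rmorphM, rmorphD, rmorph_nat, rmorph1).
have -> : (2 * (2 * j%:R - 1))^-1 = ((2 * (2 * j%:R - 1))^-1 : R)%:C.
  by rewrite fmorphV !(rmorphM, rmorphB, rmorph_nat, rmorph1).
rewrite /half_coef -!(rmorphM (real_complex R)) -rmorphB -rmorphM /=; congr _%:C.
by rewrite /cheb_prim; field; rewrite natr_double_pred_neq0 natr_double_succ_neq0.
Qed.

(** The shift moves the two angles by - j pi - pi/2 and - j pi + pi/2: the common part gives the
    sign, and the quarter turns give sin and - sin, which turns the difference into a sum. *)
Lemma cheb_prim_Bpihalf (R : realType) j (y : R) :
  cheb_prim j (y - pi / 2) = (-1) ^+ j *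
    (sin ((2 * j%:R + 1) * y) / (2 * j%:R + 1)
     + sin ((2 * j%:R - 1) * y) / (2 * j%:R - 1)) / 2.
Proof.
rewrite /cheb_prim.
have -> : (2 * j%:R + 1) * (y - pi / 2) = (2 * j%:R + 1) * y - j%:R * pi - pi / 2.
  by field.
have -> : (2 * j%:R - 1) * (y - pi / 2) = (2 * j%:R - 1) * y - j%:R * pi + pi / 2.
  by field.
rewrite cosBpihalf cosDpihalf.
have sin_sub a : sin (a - j%:R * pi) = (-1) ^+ j * sin a :> R.
  have := sinDnatpi R (a - j%:R * pi) j; rewrite subrK => ->.
  by rewrite mulrA -expr2 sqrr_sign mul1r.
by rewrite !sin_sub; field; rewrite natr_double_pred_neq0 natr_double_succ_neq0.
Qed.

Lemma leval_lI_sin (R : realType) k d (y : R) :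
  leval (lI_sin k d) (expi y)
    = (\sum_(j < d.+1) cheb_coef k j * cheb_prim j (y - pi / 2))%:C.
Proof.
have i_neq0 : 'i%C != 0 :> R[i] by rewrite eq_complex /= oner_eq0 andbF.
have i2 : 'i%C ^+ 2 = -1 :> R[i] by exact: sqr_i.
rewrite /lI_sin levalD levalZ leval_zpowBN leval_sum big_add1 big_mkord.
rewrite big_ord_recl rmorphD rmorph_sum /=; congr (_ + _).
  rewrite mulrA -[_ * - 'i%C * 'i%C]mulrA mulNr -expr2 i2 opprK mulr1.
  rewrite /half_coef -rmorphM cheb_prim_Bpihalf /=; congr _%:C.
  have -> : (2 * 0 - 1) * y = - y by ring.
  have -> : (2 * 0 + 1) * y = y by ring.
  by rewrite mul1r sinN expr0; field.
apply: eq_bigr => j _; rewrite /bump /= add1n.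
set m := j.+1.
rewrite -[- (2 * m%:Z) - 1]opprD (_ : - (2 * m%:Z) + 1 = - (2 * m%:Z - 1)); last first.
  by rewrite opprB addrC.
rewrite levalZ levalD !levalZ !leval_zpowBN cheb_prim_Bpihalf.
have -> : (2 * m%:Z - 1)%:~R = 2 * m%:R - 1 :> R by rewrite intrB intrM.
have -> : (2 * m%:Z + 1)%:~R = 2 * m%:R + 1 :> R by rewrite intrD intrM.
have n1 := natr_double_pred_neq0 R[i] m.
have n2 := natr_double_succ_neq0 R[i] m.
rewrite !(rmorphM, rmorphD, rmorphB, rmorphXn, rmorphN1, fmorphV, rmorph_nat, rmorph1) /=.
by field; rewrite n1 n2 i_neq0.
Qed.

(** * Degrees of Laurent polynomials *)

(** Unlike a bound on [ldeg], whose maximum reacts to cancellations and to the zero polynomial, this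
    property passes directly to linear combinations. *)
Definition vanishes_above {R : realType} (D : int) (L : laurent R) : Prop :=
  forall k : int, D < k -> coeff k L = 0.

Lemma vanishes_aboveD (R : realType) D (L M : laurent R) :
  vanishes_above D L -> vanishes_above D M -> vanishes_above D (L + M).
Proof. by move=> L0 M0 k Dk; rewrite coeffD L0 // M0 // addr0. Qed.

Lemma vanishes_aboveZ (R : realType) D a (L : laurent R) :
  vanishes_above D L -> vanishes_above D (a *: L).
Proof. by move=> L0 k Dk; rewrite coeffZ L0 // mulr0. Qed.

Lemma vanishes_aboveB (R : realType) D (L M : laurent R) :
  vanishes_above D L -> vanishes_above D M -> vanishes_above D (L - M).
Proof. by move=> L0 M0 k Dk; rewrite coeffB L0 // M0 // subr0. Qed.

Lemma vanishes_above_sum (R : realType) D I (r : seq I) (P : pred I)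
    (F : I -> laurent R) :
  (forall i, P i -> vanishes_above D (F i)) ->
  vanishes_above D (\sum_(i <- r | P i) F i).
Proof.
move=> F0; elim/big_ind: _ => [k _|L M|]; [exact: coeff0 | | exact: F0].
exact: vanishes_aboveD.
Qed.

Lemma vanishes_above_zpow (R : realType) (D m : int) :
  m <= D -> vanishes_above D (zpow m : laurent R).
Proof.
by move=> mD k Dk; rewrite coeffU lt_eqF ?mulr0 // (le_lt_trans mD).
Qed.

Lemma ldeg_le (R : realType) (D : int) (L : laurent R) :
  0 <= D -> vanishes_above D L -> ldeg L <= D.
Proof.
move=> D0 L0.
have domD k : k \in dom L -> k <= D.
  by rewrite mem_dom; apply: contraNT; rewrite -ltNge => /L0 ->.
rewrite /ldeg big_seq; elim/big_ind: _ => //.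
  (* The maximum starts from the head of the support, or from 0 when the support is empty; [D0]
     settles the latter. *)
  by case: (dom L) domD => //= k s domD; apply: domD; rewrite mem_head.
by move=> k l kD lD; rewrite ge_max kD.
Qed.

(* The sum rule comes last, since scaling unfolds to a sum. *)
Ltac laurent_degree :=
  repeat (first [ apply: vanishes_above_zpow
                | apply: vanishes_aboveZ
                | apply: vanishes_aboveB
                | apply: vanishes_aboveD
                | apply: vanishes_above_sum => ? ? ]).

Lemma vanishes_above_lpnd_cos (R : realType) n d :
  vanishes_above d%:Z (lpnd_cos n d : laurent R).
Proof.
apply: vanishes_above_sum => j _.
by have jd := ltn_ord j; laurent_degree; lia.
Qed.

Lemma vanishes_above_lpnd_sin (R : realType) n d :
  vanishes_above d%:Z (lpnd_sin n d : laurent R).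
Proof.
apply: vanishes_above_sum => j _.
by have jd := ltn_ord j; laurent_degree; lia.
Qed.

Lemma vanishes_above_lpnd_T2cos (R : realType) n d :
  vanishes_above (2 * d%:Z) (lpnd_T2cos n d : laurent R).
Proof.
apply: vanishes_above_sum => j _.
by have jd := ltn_ord j; laurent_degree; lia.
Qed.

Lemma vanishes_above_lpnd_T2sin (R : realType) n d :
  vanishes_above (2 * d%:Z) (lpnd_T2sin n d : laurent R).
Proof.
apply: vanishes_above_sum => j _.
by have jd := ltn_ord j; laurent_degree; lia.
Qed.

Lemma vanishes_above_lI_cos (R : realType) k d :
  vanishes_above (2 * d%:Z + 1) (lI_cos k d : laurent R).
Proof.
apply: vanishes_above_sum => j _.
by have jd := ltn_ord j; laurent_degree; lia.
Qed.

Lemma vanishes_above_lI_sin (R : realType) k d :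
  vanishes_above (2 * d%:Z + 1) (lI_sin k d : laurent R).
Proof.
apply: vanishes_aboveD; first by laurent_degree; lia.
rewrite big_add1 big_mkord; apply: vanishes_above_sum => j _.
by have jd := ltn_ord j; laurent_degree; lia.
Qed.

Lemma vanishes_above_lexp_sum (R : realType) D (a b : R) t F :
  (forall k, vanishes_above D (F k)) -> vanishes_above D (lexp_sum a b t F).
Proof. by move=> F0; laurent_degree; exact: F0. Qed.

(** * Chebyshev polynomials *)

(** [cheb] is built from [acos]; genuine polynomials are needed to differentiate and to integrate.
    [chebU], the second kind, describes their derivatives. *)
Fixpoint chebT {R : realType} (n : nat) : {poly R} :=
  if n is m.+1 then if m is k.+1 then 'X * chebT m *+ 2 - chebT k else 'X else 1.

Fixpoint chebU {R : realType} (n : nat) : {poly R} :=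
  if n is m.+1 then if m is k.+1 then 'X * chebU m *+ 2 - chebU k else 'X *+ 2
  else 1.

Lemma chebTSS (R : realType) n :
  chebT n.+2 = 'X * chebT n.+1 *+ 2 - chebT n :> {poly R}.
Proof. by []. Qed.

Lemma chebUSS (R : realType) n :
  chebU n.+2 = 'X * chebU n.+1 *+ 2 - chebU n :> {poly R}.
Proof. by []. Qed.

Lemma nat_ind2 (P : nat -> Prop) :
  P 0%N -> P 1%N -> (forall n, P n -> P n.+1 -> P n.+2) -> forall n, P n.
Proof.
move=> P0 P1 PS n; suff [] : P n /\ P n.+1 by [].
by elim: n => // n [Pn PSn]; split=> //; exact: PS.
Qed.

Lemma chebT_cos (R : realType) n (y : R) : (chebT n).[cos y] = cos (n%:R * y).
Proof.
elim/nat_ind2: n => [||n IHn IHSn].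
- by rewrite hornerC mul0r cos0.
- by rewrite hornerX mul1r.
rewrite chebTSS !hornerE IHn IHSn.
have -> : n%:R * y = n.+1%:R * y - y by rewrite -natr1; ring.
have -> : n.+2%:R * y = n.+1%:R * y + y by rewrite -[n.+2%:R]natr1; ring.
by rewrite cosB cosD; ring.
Qed.

Lemma cheb_cos (R : realType) n (y : R) : cheb n (cos y) = cos (n%:R * y).
Proof.
rewrite /cheb -!chebT_cos acosK // in_itv /=.
by rewrite cos_geN1 cos_le1.
Qed.

(** Both sides obey the same three-term recurrence and agree for the first two indices. The identity
    makes T_{2j} the derivative of a combination of T_{2j+1} and T_{2j-1}. *)
Lemma chebU_sub (R : realType) n :
  chebU n.+2 - chebU n = chebT n.+2 *+ 2 :> {poly R}.
Proof.
elim/nat_ind2: n => [||n IHn IHSn].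
- by rewrite /=; ring.
- by rewrite /=; ring.
have -> : chebU n.+4 - chebU n.+2
  = 'X * (chebU n.+3 - chebU n.+1) *+ 2 - (chebU n.+2 - chebU n) :> {poly R}.
  rewrite (chebUSS R n.+2) {2}(chebUSS R n).
  by move: (chebU n) (chebU n.+1) (chebU n.+2) (chebU n.+3) => *; ring.
rewrite IHn IHSn (chebTSS R n.+2).
by move: (chebT n.+2) (chebT n.+3) => *; ring.
Qed.

Lemma deriv_chebT (R : realType) n :
  (chebT n.+1)^`() = chebU n *+ n.+1 :> {poly R}.
Proof.
elim/nat_ind2: n => [||n IHn IHSn].
- by rewrite derivX /= mulr1n.
- by rewrite /= !poly.derivE; ring.
rewrite chebTSS derivB derivMn derivM derivX IHn IHSn mul1r mulrnDl.
(* [chebU_sub] removes the term 2 T that the product rule creates, which leaves an identity among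
   the U alone. *)
rewrite -chebU_sub [in RHS]mulrS {3}(chebUSS R n).
by move: (chebU n) (chebU n.+1) (chebU n.+2) => *; ring.
Qed.

Lemma chebT_odd0 (R : realType) j : (chebT j.*2.+1).[0] = 0 :> R.
Proof.
elim: j => [|j IHj]; first by rewrite hornerX.
by rewrite doubleS chebTSS !hornerE IHj; ring.
Qed.

(** The antiderivative of T_{2j} that vanishes at 0. The case j = 0 is apart because the general
    formula would involve T_{-1}. *)
Definition chebT_prim {R : realType} (j : nat) : {poly R} :=
  if j is i.+1 then
    2^-1 *: (j.*2.+1%:R^-1 *: chebT j.*2.+1 - i.*2.+1%:R^-1 *: chebT i.*2.+1)
  else 'X.

Lemma deriv_chebT_prim (R : realType) j :
  (chebT_prim j)^`() = chebT j.*2 :> {poly R}.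
Proof.
case: j => [|j]; first by rewrite derivX.
rewrite /chebT_prim derivZ derivB !derivZ !deriv_chebT.
have scaleMn (m : nat) (p : {poly R}) : m.+1%:R^-1 *: (p *+ m.+1) = p.
  by rewrite -[p *+ _]scaler_nat scalerA mulVf ?pnatr_eq0 // scale1r.
by rewrite !scaleMn doubleS chebU_sub scaleMn.
Qed.

Lemma chebT_prim0 (R : realType) j : (chebT_prim j).[0] = 0 :> R.
Proof.
case: j => [|j]; first by rewrite hornerX.
by rewrite /chebT_prim !hornerE !chebT_odd0; ring.
Qed.

Lemma horner_chebT_prim (R : realType) j (y : R) :
  (chebT_prim j).[cos y] = cheb_prim j y.
Proof.
rewrite /cheb_prim; case: j => [|j].
  have -> : (2 * 0 - 1) * y = - y by ring.
  have -> : (2 * 0 + 1) * y = y by ring.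
  by rewrite hornerX cosN; field.
rewrite /chebT_prim hornerZ hornerD hornerN !hornerZ !chebT_cos.
have -> : j.+1.*2.+1%:R = 2 * j.+1%:R + 1 :> R by rewrite -natr1 -mul2n natrM.
have -> : j.*2.+1%:R = 2 * j.+1%:R - 1 :> R by rewrite -!natr1 -mul2n natrM; ring.
move: (natr_double_pred_neq0 R j.+1) (natr_double_succ_neq0 R j.+1).
by move: j.+1%:R => a a1 a2; field; rewrite a1 a2.
Qed.

(** Both denominators 2 j + 1 and 2 j - 1 are at least j once j >= 1, and the outer factor 1/2
    averages the two terms. *)
Lemma cheb_prim_le (R : realType) j m (y : R) : (0 < m)%N -> (m <= j)%N ->
  `|cheb_prim j y| <= m%:R^-1.
Proof.
move=> m0 mj; have m0' : 0 < m%:R :> R by rewrite ltr0n.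
have m1' : 1 <= m%:R :> R by rewrite ler1n.
have mj' : m%:R <= j%:R :> R by rewrite ler_nat.
have bound (a b : R) : m%:R <= b -> `|cos a / b| <= m%:R^-1.
  move=> mb; have b0 : 0 < b by lra.
  rewrite normrM normfV (gtr0_norm b0) -[leRHS]mul1r.
  by apply: ler_pM; rewrite ?invr_ge0 ?cos_max ?lef_pV2 ?posrE // ltW.
rewrite /cheb_prim normrM [`|2^-1|]ger0_norm ?invr_ge0 // ler_pdivrMr //.
apply: le_trans (ler_normB _ _) _; rewrite [leRHS]mulr_natr [leRHS]mulr2n.
by apply: lerD; apply: bound; lra.
Qed.

(** * Integrals *)

Lemma Rintegral_deriv_horner (R : realType) (p : {poly R}) (a b : R) : a <= b ->
  \int[lebesgue_measure]_(u in `[a, b]) (p^`()).[u] = p.[b] - p.[a].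
Proof.
rewrite le_eqVlt => /predU1P[->|ab]; first by rewrite set_itv1 Rintegral_set1 subrr.
rewrite /Rintegral (@continuous_FTC2 _ _ (horner p)) //.
- exact/continuous_subspaceT/continuous_horner.
- split=> [x _||]; first exact: derivable_horner.
    by apply: cvg_at_right_filter; exact: continuous_horner.
  by apply: cvg_at_left_filter; exact: continuous_horner.
- by move=> x _; rewrite derivE.
Qed.

Lemma Rintegral_dist_le (R : realType) (f g : R -> R) (a b M : R) :
  continuous f -> continuous g -> a <= b -> b - a <= 1 ->
  {in `[a, b], forall u, `|f u - g u| <= M} ->
  `|\int[lebesgue_measure]_(u in `[a, b]) f u
    - \int[lebesgue_measure]_(u in `[a, b]) g u| <= M.
Proof.
move=> cf cg ab ba fgM.
have intc (h : R -> R) : continuous h ->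
    (lebesgue_measure : measure _ R).-integrable `[a, b] (EFin \o h).
  move=> ch; apply: continuous_compact_integrable; first exact: segment_compact.
  exact: continuous_subspaceT.
have M0 : 0 <= M.
  by apply: le_trans (fgM a _); rewrite ?normr_ge0 // in_itv /= lexx.
have cfg : continuous (fun u => f u - g u).
  by move=> u; apply: cvgB; [exact: cf|exact: cg].
rewrite -RintegralB //; [|exact: intc|exact: intc].
apply: le_trans (le_normr_Rintegral _ _) _ => //; first exact: intc.
apply: (@le_trans _ _ (\int[lebesgue_measure]_(u in `[a, b]) M)).
  apply: le_Rintegral => //.
  - by apply: intc => u; apply: cvg_norm; exact: cfg.
  - by apply: intc => u; exact: cvg_cst.
rewrite Rintegral_cst //= lebesgue_measure_itv /= lte_fin.
case: ifP => _ /=; last by rewrite mulr0.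
by rewrite -[leRHS]mulr1; apply: ler_wpM2l.
Qed.

Lemma integral0_deriv_horner (R : realType) (p : {poly R}) (x : R) :
  integral0 (fun u => (p^`()).[u]) x = p.[x] - p.[0].
Proof.
rewrite /integral0; case: (leP 0 x) => [x0|/ltW x0].
  by rewrite Rintegral_deriv_horner.
by rewrite Rintegral_deriv_horner // opprB.
Qed.

(** Agreement is asked only on [-1, 1], where [cheb] coincides with the Chebyshev polynomial. *)
Lemma eq_integral0 (R : realType) (f g : R -> R) (x : R) : -1 <= x <= 1 ->
  (forall u, -1 <= u <= 1 -> f u = g u) -> integral0 f x = integral0 g x.
Proof.
move=> /andP[x1 x2] fg; rewrite /integral0; case: (leP 0 x) => [x0|/ltW x0].
  by apply: eq_Rintegral => u; rewrite inE /= in_itv /= => /andP[u0 ux]; apply: fg; lra.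
congr (- _).
by apply: eq_Rintegral => u; rewrite inE /= in_itv /= => /andP[u0 ux]; apply: fg; lra.
Qed.

Lemma integral0_dist_le (R : realType) (f g : R -> R) (x M : R) :
  continuous f -> continuous g -> -1 <= x <= 1 ->
  (forall u, -1 <= u <= 1 -> `|f u - g u| <= M) ->
  `|integral0 f x - integral0 g x| <= M.
Proof.
move=> cf cg /andP[x1 x2] fgM; rewrite /integral0; case: (leP 0 x) => [x0|/ltW x0].
  apply: Rintegral_dist_le => //; first by lra.
  by move=> u; rewrite in_itv /= => /andP[u0 ux]; apply: fgM; lra.
rewrite -opprD normrN; apply: Rintegral_dist_le => //; first by lra.
by move=> u; rewrite in_itv /= => /andP[u0 ux]; apply: fgM; lra.
Qed.

Lemma pnd_cos (R : realType) n d (y : R) :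
  pnd n d (cos y) = \sum_(j < d.+1) cheb_coef n j * cos (j%:R * y).
Proof. by rewrite /pnd; apply: eq_bigr => j _; rewrite cheb_cos. Qed.

Lemma cheb2_cos (R : realType) (y : R) : cheb 2 (cos y) = cos (2 * y).
Proof. exact: cheb_cos. Qed.

Lemma cheb2_sin (R : realType) (y : R) : cheb 2 (sin y) = cos (2 * y + pi).
Proof.
rewrite -cosBpihalf cheb2_cos.
have -> : 2 * y + pi = 2 * (y - pi / 2) + pi *+ 2 by rewrite mulr2n; field.
by rewrite cosD2pi.
Qed.

Definition pnd_prim {R : realType} (k d : nat) : {poly R} :=
  \sum_(j < d.+1) cheb_coef k j *: chebT_prim j.

Lemma deriv_pnd_prim (R : realType) k d (u : R) : -1 <= u <= 1 ->
  pnd k d (cheb 2 u) = (pnd_prim k d)^`().[u].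
Proof.
move=> u1; rewrite -[u]acosK ?in_itv // cheb2_cos pnd_cos.
rewrite /pnd_prim raddf_sum horner_sum; apply: eq_bigr => j _.
rewrite /= derivZ hornerZ deriv_chebT_prim chebT_cos; congr (_ * cos _).
by rewrite -mul2n natrM; ring.
Qed.

Lemma pnd_prim0 (R : realType) k d : (pnd_prim k d).[0] = 0 :> R.
Proof.
by rewrite horner_sum big1 // => j _; rewrite hornerZ chebT_prim0 mulr0.
Qed.

Lemma Iint_horner (R : realType) k d (x : R) : -1 <= x <= 1 ->
  Iint k d x = (pnd_prim k d).[x].
Proof.
move=> x1; rewrite /Iint (eq_integral0 _ _ (horner (pnd_prim k d)^`())) //; last first.
  by move=> u u1; exact: deriv_pnd_prim.
by rewrite integral0_deriv_horner pnd_prim0 subr0.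
Qed.

Lemma pnd_prim_cos (R : realType) k d (y : R) :
  (pnd_prim k d).[cos y] = \sum_(j < d.+1) cheb_coef k j * cheb_prim j y.
Proof.
by rewrite horner_sum; apply: eq_bigr => j _; rewrite hornerZ horner_chebT_prim.
Qed.

(** * Approximation errors *)

Lemma delta_approx_real (R : realType) (delta : R) (F G : R -> R[i]) (f g : R -> R) :
  (forall y, F y = (f y)%:C) -> (forall y, G y = (g y)%:C) ->
  (forall y, `|f y - g y| <= delta) -> delta_approx delta F G.
Proof.
move=> Ff Gg fg; apply: ub_ereal_sup => _ [y _ <-].
rewrite lee_fin Ff Gg -rmorphB /= expr0n /= addr0 sqrtr_sqr.
exact: fg.
Qed.

Lemma leval_lexp_sum (R : realType) (a b : R) t (F : nat -> laurent R)
    (f : nat -> R) z :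
  (forall k, leval (F k) z = (f k)%:C) ->
  leval (lexp_sum a b t F) z = (exp_sum a b t f)%:C.
Proof.
move=> Ff; rewrite levalZ leval_sum /exp_sum rmorphM rmorph_sum /=.
by congr (_ * _); apply: eq_bigr => k _; rewrite levalZ Ff -rmorphM.
Qed.

(** In absolute value the weights are e^{-b} b^k / k!, with sum at most 1. *)
Lemma exp_sum_dist_le (R : realType) (b M : R) t (f g : nat -> R) :
  0 <= b -> (forall k, (k <= t)%N -> `|f k - g k| <= M) ->
  `|exp_sum (expR (- b)) b t f - exp_sum (expR (- b)) b t g| <= M.
Proof.
move=> b0 fg; have M0 : 0 <= M := le_trans (normr_ge0 _) (fg 0%N isT).
rewrite /exp_sum -mulrBr -sumrB normrM ger0_norm ?expR_ge0 // expRN mulrC.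
rewrite ler_pdivrMr ?expR_gt0 //; apply: le_trans (ler_norm_sum _ _ _) _.
apply: (@le_trans _ _ (\sum_(k < t.+1) M * (b ^+ k / k`!%:R))).
  apply: ler_sum => k _; rewrite -mulrBr normrM mulrC.
  rewrite normrM normrX normrN (ger0_norm b0) [`|_^-1|]ger0_norm ?invr_ge0 //.
  apply: ler_wpM2r; first by rewrite divr_ge0 // exprn_ge0.
  by apply: fg; rewrite -ltnS.
rewrite -mulr_sumr; apply: ler_wpM2l => //.
exact: exp_partial_sum_le.
Qed.

(** The series tail at -b x is at most 2^{-(t+1)} e^{2b}, and the prefactor e^{-b} leaves e^b. *)
Lemma exp_sum_pow_le (R : realType) (b x : R) t : 0 <= b -> `|x| <= 1 ->
  `|exp_sum (expR (- b)) b t (fun k => x ^+ k) - expR (- b * (1 + x))|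
    <= expR b * 2 ^- t.+1.
Proof.
move=> b0 x1; have -> : - b * (1 + x) = - b + - b * x by ring.
rewrite expRD /exp_sum -mulrBr normrM ger0_norm ?expR_ge0 // distrC.
under eq_bigr => k _ do rewrite mulrAC -exprMn.
apply: (@le_trans _ _ (expR (- b) * (2 ^- t.+1 * expR (2 * b)))).
  apply: ler_wpM2l; first exact: expR_ge0.
  apply: le_trans (exp_partial_sum_tail_le _ _ _) _.
  apply: ler_wpM2l; first by rewrite invr_ge0 exprn_ge0.
  rewrite ler_expR; apply: ler_wpM2l => //.
  by rewrite normrM normrN (ger0_norm b0) -[leRHS]mulr1; apply: ler_wpM2l.
rewrite mulrCA -expRD mulrC (_ : - b + 2 * b = b) //; ring.
Qed.

Lemma pnd_cos_le (R : realType) n d (y : R) :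
  `|pnd n d (cos y) - cos y ^+ n| <= cheb_tail n d.+1.
Proof.
rewrite pnd_cos -cheb_coef_sum_cos distrC -[leRHS]mul1r.
apply: (@cheb_coef_sum_tail_le R n d.+1 (fun j => cos (j%:R * y))) => j _.
exact: cos_max.
Qed.

Lemma exp_sum_pnd_cos_le (R : realType) (b y : R) t d : 0 <= b -> (0 < t)%N ->
  `|exp_sum (expR (- b)) b t (fun k => pnd k d (cos y)) - expR (- b * (1 + cos y))|
    <= 2 * expR (- (d.+1%:R ^+ 2 / (8 * t%:R))) + expR (3 * b) * 2 ^- t.+1.
Proof.
move=> b0 t0.
apply: le_trans (ler_distD (exp_sum (expR (- b)) b t (fun k => cos y ^+ k)) _ _) _.
apply: lerD.
  apply: exp_sum_dist_le => // k kt.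
  exact: le_trans (pnd_cos_le _ _ _ _) (cheb_tail_le_expRW _ _ _ _ kt t0 _).
apply: le_trans (exp_sum_pow_le _ _ _ _ b0 (cos_max _)) _.
apply: ler_wpM2r; first by rewrite invr_ge0 exprn_ge0.
(* The weaker e^{3b} is the form shared with the error function in [exists_truncation]. *)
by rewrite ler_expR; lra.
Qed.

Lemma exp_sum_horner (R : realType) (a b : R) t (P : nat -> {poly R}) x :
  exp_sum a b t (fun k => (P k).[x])
    = (a *: \sum_(k < t.+1) ((- b) ^+ k / k`!%:R) *: P k).[x].
Proof.
rewrite hornerZ horner_sum; congr (_ * _).
by apply: eq_bigr => k _; rewrite hornerZ.
Qed.

Lemma eq_exp_sum (R : realType) (a b : R) t (f g : nat -> R) :
  (forall k, f k = g k) -> exp_sum a b t f = exp_sum a b t g.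
Proof. by move=> fg; congr (_ * _); apply: eq_bigr => k _; rewrite fg. Qed.

Lemma continuous_gauss (R : realType) (lambda : R) :
  continuous (fun u => expR (- (lambda * u) ^+ 2)).
Proof.
have -> : (fun u => expR (- (lambda * u) ^+ 2))
    = expR \o horner (- lambda ^+ 2 *: 'X^2).
  by apply/funext => u /=; rewrite hornerZ hornerXn exprMn mulNr.
move=> u; apply: continuous_comp; first exact: continuous_horner.
exact: continuous_expR.
Qed.

(* Untruncated in j, the sum of the integrals is the integral of a Taylor
   polynomial of the Gaussian in T_2. *)
Lemma exp_sum_Iint_full_le (R : realType) (lambda x : R) t :
  let b := lambda ^+ 2 / 2 in -1 <= x <= 1 ->
  `|exp_sum (expR (- b)) b t (fun k => Iint k k x)
    - integral0 (fun u => expR (- (lambda * u) ^+ 2)) x| <= expR b * 2 ^- t.+1.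
Proof.
move=> b x1; have b0 : 0 <= b by rewrite divr_ge0 // sqr_ge0.
(* A single polynomial vanishing at 0, so its value at x is the integral of its derivative, and the
   comparison takes place between integrands. *)
set W := expR (- b) *: \sum_(k < t.+1) ((- b) ^+ k / k`!%:R) *: pnd_prim k k.
have -> : exp_sum (expR (- b)) b t (fun k => Iint k k x)
    = integral0 (fun u => W^`().[u]) x.
  rewrite integral0_deriv_horner /W -!(exp_sum_horner _ _ _ _ (fun k => pnd_prim k k)).
  rewrite [X in _ - X](_ : _ = 0) ?subr0; last first.
    by rewrite /exp_sum big1 ?mulr0 // => k _; rewrite pnd_prim0 mulr0.
  by apply: eq_exp_sum => k; rewrite Iint_horner.
apply: integral0_dist_le => //.
- exact: continuous_horner.
- exact: continuous_gauss.
move=> u u1.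
have -> : W^`().[u] = exp_sum (expR (- b)) b t (fun k => cheb 2 u ^+ k).
  rewrite /W derivZ raddf_sum /=.
  under eq_bigr => k _ do rewrite derivZ.
  rewrite -(exp_sum_horner _ _ _ _ (fun k => (pnd_prim k k)^`())); apply: eq_exp_sum => k.
  rewrite -deriv_pnd_prim // -[u]acosK ?in_itv // cheb2_cos pnd_cos.
  exact: cheb_coef_sum_cos.
have -> : - (lambda * u) ^+ 2 = - b * (1 + cheb 2 u).
  rewrite -[u]acosK ?in_itv // cheb2_cos.
  have -> : 2 * acos u = acos u *+ 2 by rewrite mulr_natl.
  by rewrite cos_mulr2n /b; field.
apply: exp_sum_pow_le => //.
by rewrite -[u]acosK ?in_itv // cheb2_cos cos_max.
Qed.

Lemma Iint_dist_le (R : realType) k d (x : R) : -1 <= x <= 1 ->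
  `|Iint k d x - Iint k k x| <= d.+1%:R^-1 * cheb_tail k d.+1.
Proof.
move=> x1; rewrite !Iint_horner // -[x]acosK ?in_itv // !pnd_prim_cos distrC.
apply: (@cheb_coef_sum_tail_le R k d.+1 (cheb_prim^~ (acos x))) => j dj.
exact: cheb_prim_le.
Qed.

(* The factor 1 / (d + 1) gained by integrating the tail of the Chebyshev
   series compensates the factor lambda in front of the integral. *)
Lemma erf_approx_le (R : realType) (lambda x M : R) t d :
  let b := lambda ^+ 2 / 2 in
  0 < lambda -> -1 <= x <= 1 -> (0 < t)%N ->
  expR (3 * b) * 2 ^- t.+1 <= M ->
  2 * expR (- (d.+1%:R ^+ 2 / (8 * t%:R))) <= M ->
  32 * b <= d.+1%:R ^+ 2 ->
  `|exp_sum (2 * lambda * expR (- (lambda ^+ 2 / 2)) / Num.sqrt pi) b t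
      (fun k => Iint k d x) - erf_scaled lambda x| <= M + M.
Proof.
move=> b l0 x1 t0 M1 M2 bd; have b0 : 0 <= b by rewrite divr_ge0 // sqr_ge0.
have sqpi : 1 <= Num.sqrt pi :> R.
  by rewrite -[leLHS]sqrtr1 ler_sqrt ?pi_ge0 //; have := pi_ge2 R; lra.
have -> : exp_sum (2 * lambda * expR (- (lambda ^+ 2 / 2)) / Num.sqrt pi) b t
      (fun k => Iint k d x)
    = 2 * lambda / Num.sqrt pi * exp_sum (expR (- b)) b t (fun k => Iint k d x).
  by rewrite /exp_sum /b mulrA; congr (_ * _); rewrite mulrAC.
rewrite /erf_scaled -mulrBr normrM.
have c0 : 0 <= 2 * lambda / Num.sqrt pi.
  by rewrite divr_ge0 ?sqrtr_ge0 // mulr_ge0 // ltW.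
rewrite (ger0_norm c0).
have c1 : 2 * lambda / Num.sqrt pi <= 2 * lambda.
  rewrite ler_pdivrMr ?(lt_le_trans _ sqpi) // ler_peMr //.
  by rewrite mulr_ge0 // ltW.
apply: (@le_trans _ _ (2 * lambda * (expR b * 2 ^- t.+1 +
    d.+1%:R^-1 * (2 * expR (- (d.+1%:R ^+ 2 / (8 * t%:R))))))).
  apply: ler_pM => //.
  apply: le_trans (ler_distD (exp_sum (expR (- b)) b t (fun k => Iint k k x)) _ _) _.
  rewrite addrC; apply: lerD; first exact: exp_sum_Iint_full_le.
  apply: exp_sum_dist_le => // k kt.
  apply: le_trans (Iint_dist_le _ _ _ _ x1) _.
  apply: ler_wpM2l; first by rewrite invr_ge0.
  exact: cheb_tail_le_expRW.
rewrite mulrDr; apply: lerD.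
  apply: le_trans M1; rewrite mulrA.
  apply: ler_wpM2r; first by rewrite invr_ge0 exprn_ge0.
  (* The prefactor is absorbed through 2 lambda <= 1 + lambda^2 <= e^{lambda^2}. *)
  have -> : 3 * b = lambda ^+ 2 + b by rewrite /b; field.
  rewrite expRD; apply: ler_wpM2r; first exact: expR_ge0.
  apply: le_trans (expR_ge1Dx _).
  by rewrite -subr_ge0 (_ : _ - _ = (lambda - 1) ^+ 2) ?sqr_ge0 //; ring.
apply: le_trans M2; rewrite mulrA -[leRHS]mul1r.
apply: ler_wpM2r; first by rewrite mulr_ge0 ?expR_ge0.
rewrite ler_pdivrMr ?ltr0n // mul1r.
have d0 : 0 <= d.+1%:R :> R by [].
move: bd; rewrite /b => bd.
by rewrite leNgt; apply/negP => h; nra.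
Qed.

Lemma Iint_cos (R : realType) k d (y : R) :
  (Iint k d (cos y))%:C = leval (lI_cos k d) (expi y).
Proof. by rewrite leval_lI_cos Iint_horner ?cos_geN1 ?cos_le1 // pnd_prim_cos. Qed.

Lemma Iint_sin (R : realType) k d (y : R) :
  (Iint k d (sin y))%:C = leval (lI_sin k d) (expi y).
Proof.
rewrite leval_lI_sin Iint_horner ?sin_geN1 ?sin_le1 //.
by rewrite -cosBpihalf pnd_prim_cos.
Qed.

Lemma ldeg_natr_le (R : realType) (D : nat) (L : laurent R) (x : R) :
  vanishes_above D%:Z L -> D%:R <= x -> (ldeg L)%:~R <= x.
Proof. by move=> L0; apply: le_trans; rewrite (ler_int R _ D%:Z) ldeg_le. Qed.

(* In the first part the integer d is bounded by the real number
   C sqrt(n ln(1/delta)) rounded up; Num.sqrt is 0 on negative numbers, which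
   concerns delta > 1. *)
Theorem mainTheorem3 (R : realType) :
  [/\
   exists2 C : R, 0 < C & forall (n : nat) (delta : R), 0 < delta ->
     exists2 d : nat,
       d%:Z <= Num.ceil (C * Num.sqrt (n%:R * ln (1 / delta))) &
       [/\ forall y : R, (pnd n d (cos y))%:C = leval (lpnd_cos n d) (expi y),
           forall y : R, (pnd n d (sin y))%:C = leval (lpnd_sin n d) (expi y),
           delta_approx delta (fun y => leval (lpnd_cos n d) (expi y))
                              (fun y => (cos y ^+ n)%:C)
             /\ delta_approx delta (fun y => leval (lpnd_sin n d) (expi y))
                                   (fun y => (sin y ^+ n)%:C),
           ldeg (lpnd_cos n d : laurent R)
             <= Num.ceil (C * Num.sqrt (n%:R * ln (1 / delta))) &
           ldeg (lpnd_sin n d : laurent R)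
             <= Num.ceil (C * Num.sqrt (n%:R * ln (1 / delta)))],
   exists2 C : R, 0 < C & forall beta delta : R,
     0 < beta -> 0 < delta <= 1 / 2 ->
     exists t d : nat,
     let fcos y := exp_sum (expR (- beta)) beta t (fun k => pnd k d (cos y)) in
     let fsin y := exp_sum (expR (- beta)) beta t (fun k => pnd k d (sin y)) in
     let Lcos := lexp_sum (expR (- beta)) beta t (fun k => lpnd_cos k d) in
     let Lsin := lexp_sum (expR (- beta)) beta t (fun k => lpnd_sin k d) in
     [/\ t%:R <= C * (beta + ln (1 / delta)),
         d%:R <= C * Num.sqrt (t%:R * ln (1 / delta)),
         forall y : R, (fcos y)%:C = leval Lcos (expi y)
                    /\ (fsin y)%:C = leval Lsin (expi y),
         delta_approx delta (fun y => (fcos y)%:C)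
                            (fun y => (expR (- beta * (1 + cos y)))%:C)
           /\ delta_approx delta (fun y => (fsin y)%:C)
                                 (fun y => (expR (- beta * (1 + sin y)))%:C) &
         (ldeg Lcos)%:~R <= C * Num.sqrt (t%:R * ln (1 / delta))
           /\ (ldeg Lsin)%:~R <= C * Num.sqrt (t%:R * ln (1 / delta))],
   exists2 C : R, 0 < C & forall gamma delta : R,
     0 <= gamma -> 0 < delta <= 1 / 2 ->
     exists t d : nat,
     let a := expR (- (gamma ^+ 2 / 2)) in
     let b := gamma ^+ 2 / 2 in
     let fsin y := exp_sum a b t (fun k => pnd k d (cheb 2 (sin y))) in
     let Lcos := lexp_sum a b t (fun k => lpnd_T2cos k d) in
     let Lsin := lexp_sum a b t (fun k => lpnd_T2sin k d) in
     [/\ t%:R <= C * (gamma ^+ 2 + ln (1 / delta)),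
         d%:R <= C * Num.sqrt (t%:R * ln (1 / delta)),
         forall y : R,
           (forall k : nat, (pnd k d (cheb 2 (sin y)))%:C
                              = leval (lpnd_T2sin k d) (expi y))
           /\ (fsin y)%:C = leval Lsin (expi y),
         delta_approx delta (fun y => leval Lcos (expi y))
                            (fun y => (expR (- (gamma * cos y) ^+ 2))%:C)
           /\ delta_approx delta (fun y => (fsin y)%:C)
                                 (fun y => (expR (- (gamma * sin y) ^+ 2))%:C) &
         (ldeg Lcos)%:~R <= C * Num.sqrt (t%:R * ln (1 / delta))
           /\ (ldeg Lsin)%:~R <= C * Num.sqrt (t%:R * ln (1 / delta))] &
   exists delta0 C : R, [/\ 0 < delta0, 0 < C & forall lambda delta : R,
     0 < lambda -> 0 < delta <= delta0 ->
     exists t d : nat,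
     let a := 2 * lambda * expR (- (lambda ^+ 2 / 2)) / Num.sqrt pi in
     let b := lambda ^+ 2 / 2 in
     let fcos y := exp_sum a b t (fun k => Iint k d (cos y)) in
     let fsin y := exp_sum a b t (fun k => Iint k d (sin y)) in
     let Lcos := lexp_sum a b t (fun k => lI_cos k d) in
     let Lsin := lexp_sum a b t (fun k => lI_sin k d) in
     [/\ t%:R <= C * (lambda ^+ 2 + ln (1 / delta)),
         d%:R <= C * Num.sqrt (t%:R * ln (1 / delta)),
         forall y : R,
           [/\ forall k : nat, (Iint k d (cos y))%:C
                                 = leval (lI_cos k d) (expi y),
               forall k : nat, (Iint k d (sin y))%:C
                                 = leval (lI_sin k d) (expi y),
               (fcos y)%:C = leval Lcos (expi y) &
               (fsin y)%:C = leval Lsin (expi y)],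
         delta_approx delta (fun y => (fcos y)%:C)
                            (fun y => (erf_scaled lambda (cos y))%:C)
           /\ delta_approx delta (fun y => (fsin y)%:C)
                                 (fun y => (erf_scaled lambda (sin y))%:C) &
         (ldeg Lcos)%:~R <= C * Num.sqrt (t%:R * ln (1 / delta))
           /\ (ldeg Lsin)%:~R <= C * Num.sqrt (t%:R * ln (1 / delta))]]].
Proof.
split.
- exists 40 => // n delta delta0.
  have [d dE tail] := exists_cheb_tail_le _ n _ delta0.
  have cosE y : (pnd n d (cos y))%:C = leval (lpnd_cos n d) (expi y) :> R[i].
    by rewrite leval_lpnd_cos pnd_cos.
  have sinE y : (pnd n d (sin y))%:C = leval (lpnd_sin n d) (expi y) :> R[i].
    by rewrite leval_lpnd_sin -cosBpihalf pnd_cos.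
  exists d; first by rewrite dE.
  split=> //; [split| |].
  + apply: (delta_approx_real _ _ _ _ (fun y => pnd n d (cos y))
      (fun y => cos y ^+ n)) => // y.
    exact: le_trans (pnd_cos_le _ _ _ _) tail.
  + apply: (delta_approx_real _ _ _ _ (fun y => pnd n d (sin y))
      (fun y => sin y ^+ n)) => // y.
    by rewrite -cosBpihalf; exact: le_trans (pnd_cos_le _ _ _ _) tail.
  + by rewrite -dE; apply: ldeg_le => //; exact: vanishes_above_lpnd_cos.
  + by rewrite -dE; apply: ldeg_le => //; exact: vanishes_above_lpnd_sin.
(* 22 serves all remaining parts: with s = sqrt (t L), d <= 10 s and 1 <= 2 s give 2 d + 1 <= 22
   s. *)
- exists 22 => // beta delta beta0 delta12.
  have beta0' := ltW beta0.
  have L2 := ln_inv_ge_half _ _ delta12.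
  have [t [d [t0 tle dle xge [M1 M2 _]]]] := exists_truncation _ _ _ beta0' delta12.
  exists t, d => fcos fsin Lcos Lsin.
  have cosE y : (fcos y)%:C = leval Lcos (expi y).
    rewrite (leval_lexp_sum _ _ _ _ _ (fun k => pnd k d (cos y))) // => k.
    by rewrite leval_lpnd_cos pnd_cos.
  have sinE y : (fsin y)%:C = leval Lsin (expi y).
    rewrite (leval_lexp_sum _ _ _ _ _ (fun k => pnd k d (sin y))) // => k.
    by rewrite leval_lpnd_sin -cosBpihalf pnd_cos.
  have err y := exp_sum_pnd_cos_le _ _ y t d beta0' t0.
  split=> //; [lra|lra|split|split].
  + apply: (delta_approx_real _ _ _ _ fcos
      (fun y => expR (- beta * (1 + cos y)))) => // y.
    by apply: le_trans (err y) _; lra.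
  + apply: (delta_approx_real _ _ _ _ fsin
      (fun y => expR (- beta * (1 + sin y)))) => // y.
    by rewrite /fsin -cosBpihalf; apply: le_trans (err _) _; lra.
  + apply: (ldeg_natr_le _ d); last by lra.
    by apply: vanishes_above_lexp_sum => k; exact: vanishes_above_lpnd_cos.
  + apply: (ldeg_natr_le _ d); last by lra.
    by apply: vanishes_above_lexp_sum => k; exact: vanishes_above_lpnd_sin.
- exists 22 => // gamma delta gamma0 delta12.
  have b0 : 0 <= gamma ^+ 2 / 2 by rewrite divr_ge0 // sqr_ge0.
  have L2 := ln_inv_ge_half _ _ delta12.
  have [t [d [t0 tle dle xge [M1 M2 _]]]] := exists_truncation _ _ _ b0 delta12.
  exists t, d => a b fsin Lcos Lsin.
  have cosE y : leval Lcos (expi y)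
      = (exp_sum a b t (fun k => pnd k d (cos (2 * y))))%:C.
    rewrite (leval_lexp_sum _ _ _ _ _ (fun k => pnd k d (cos (2 * y)))) // => k.
    by rewrite leval_lpnd_T2cos pnd_cos.
  have pndE k y : (pnd k d (cheb 2 (sin y)))%:C = leval (lpnd_T2sin k d) (expi y) :> R[i].
    by rewrite leval_lpnd_T2sin cheb2_sin pnd_cos.
  have sinE y : (fsin y)%:C = leval Lsin (expi y).
    by rewrite (leval_lexp_sum _ _ _ _ _ (fun k => pnd k d (cheb 2 (sin y)))).
  (* The estimate of part (2) with b = gamma^2 / 2, taken at the angle 2 y for the cosine and 2 y +
     pi for the sine. *)
  have err y := exp_sum_pnd_cos_le _ _ y t d b0 t0.
  have g0 := sqr_ge0 gamma.
  split=> //; [lra|lra|split|split].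
  + apply: (delta_approx_real _ _ _ _ _
      (fun y => expR (- (gamma * cos y) ^+ 2)) cosE) => // y.
    have -> : - (gamma * cos y) ^+ 2 = - b * (1 + cos (2 * y)).
      have -> : 2 * y = y *+ 2 by rewrite mulr_natl.
      by rewrite cos_mulr2n /b; field.
    by apply: le_trans (err _) _; lra.
  + apply: (delta_approx_real _ _ _ _ fsin
      (fun y => expR (- (gamma * sin y) ^+ 2))) => // y.
    have -> : - (gamma * sin y) ^+ 2 = - b * (1 + cos (2 * y + pi)).
      have -> : 2 * y = y *+ 2 by rewrite mulr_natl.
      by rewrite cosDpi cos_mulr2n cos2sin2 /b; field.
    rewrite /fsin (eq_exp_sum _ _ _ _ _ (fun k => pnd k d (cos (2 * y + pi)))).
      by apply: le_trans (err _) _; lra.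
    by move=> k; rewrite cheb2_sin.
  + apply: (ldeg_natr_le _ (2 * d)); last by rewrite natrM; lra.
    by apply: vanishes_above_lexp_sum => k; exact: vanishes_above_lpnd_T2cos.
  + apply: (ldeg_natr_le _ (2 * d)); last by rewrite natrM; lra.
    by apply: vanishes_above_lexp_sum => k; exact: vanishes_above_lpnd_T2sin.
- exists (1 / 2), 22; split=> // lambda delta lambda0 delta12.
  have b0 : 0 <= lambda ^+ 2 / 2 by rewrite divr_ge0 // sqr_ge0.
  have L2 := ln_inv_ge_half _ _ delta12.
  have [t [d [t0 tle dle xge [M1 M2 M3]]]] := exists_truncation _ _ _ b0 delta12.
  exists t, d => a b fcos fsin Lcos Lsin.
  have cosE y : (fcos y)%:C = leval Lcos (expi y).
    rewrite (leval_lexp_sum _ _ _ _ _ (fun k => Iint k d (cos y))) // => k.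
    by rewrite Iint_cos.
  have sinE y : (fsin y)%:C = leval Lsin (expi y).
    rewrite (leval_lexp_sum _ _ _ _ _ (fun k => Iint k d (sin y))) // => k.
    by rewrite Iint_sin.
  have err x : -1 <= x <= 1 ->
      `|exp_sum a b t (fun k => Iint k d x) - erf_scaled lambda x| <= delta.
    move=> x1; apply: le_trans (erf_approx_le _ _ _ _ _ _ lambda0 x1 t0 M1 M2 M3) _.
    by lra.
  have l0 := sqr_ge0 lambda.
  split=> //; [lra|lra| |split|split].
  + by move=> y; split=> // k; [exact: Iint_cos | exact: Iint_sin].
  + apply: (delta_approx_real _ _ _ _ fcos
      (fun y => erf_scaled lambda (cos y))) => // y.
    by apply: err; rewrite cos_geN1 cos_le1.
  + apply: (delta_approx_real _ _ _ _ fsin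
      (fun y => erf_scaled lambda (sin y))) => // y.
    by apply: err; rewrite sin_geN1 sin_le1.
  + apply: (ldeg_natr_le _ (2 * d + 1)); last by rewrite natrD natrM; lra.
    by apply: vanishes_above_lexp_sum => k; exact: vanishes_above_lI_cos.
  + apply: (ldeg_natr_le _ (2 * d + 1)); last by rewrite natrD natrM; lra.
    by apply: vanishes_above_lexp_sum => k; exact: vanishes_above_lI_sin.
Qed.
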